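(* Let $1\le r\le n$ be integers, let $(I,J,K)\in\widetilde T^n_r$, and set $i_0=j_0=k_0=0$. Suppose there are $u,v,w\in\{0,\dots,r\}$ such that (a) $u+v+w=r$; (b) $u=r$ or $i_{u+1}-i_u\ge2$; (c) $v=r$ or $j_{v+1}-j_v\ge2$; (d) $w=r$ or $k_{w+1}-k_w\ge2$; (e) $i_u+j_v+k_w\le n-1$. Define $\widetilde I=\{\tilde i_1,\dots,\tilde i_r\}$, $\widetilde J=\{\tilde j_1,\dots,\tilde j_r\}$, $\widetilde K=\{\tilde k_1,\dots,\tilde k_r\}$ by $$\tilde i_p=\begin{cases}i_p,&1\le p\le u\\ i_p-1,&u<p\le r,\end{cases}\qquad \tilde j_p=\begin{cases}j_p,&1\le p\le v\\ j_p-1,&v<p\le r,\end{cases}\qquad \tilde k_p=\begin{cases}k_p,&1\le p\le w\\ k_p-1,&w<p\le r.\end{cases}$$ Then $c^{(n-1)}(\widetilde I,\widetilde J,\widetilde K)=c^{(n)}(I,J,K)$.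
   Context: Subsets of $\{1,\dots,n\}$ are indexed increasingly: $I=\{i_1<\cdots<i_r\}$, and likewise $J=\{j_1<\cdots<j_r\}$, $K=\{k_1<\cdots<k_r\}$. Horn sets. For $1\le r\le n$, let $U^n_r$ be the set of triples $(I,J,K)$ of subsets of $\{1,\dots,n\}$ of cardinality $r$ with $\sum_{i\in I}i+\sum_{j\in J}j=\sum_{k\in K}k+\frac{r(r+1)}2$. Put $T^n_1=U^n_1$ and, for $r\ge2$, recursively let $T^n_r$ be the set of $(I,J,K)\in U^n_r$ such that $\sum_{f\in F}i_f+\sum_{g\in G}j_g\le\sum_{h\in H}k_h+\frac{p(p+1)}2$ for all $1\le p<r$ and all $(F,G,H)\in T^r_p$. Let $\sigma_n(i)=n+1-i$ on $\{1,\dots,n\}$ and $\widetilde T^n_r=\{(\sigma_n(I),\sigma_n(J),K)\mid (I,J,K)\in T^n_r\}$. Littlewood–Richardson coefficients. For a set $I=\{i_1<\cdots<i_r\}$ of positive integers let $\rho_r(I)=(i_r-r,i_{r-1}-(r-1),\dots,i_1-1)$, a weakly decreasing $r$-tuple of nonnegative integers. For any $n$ and subsets $I,J,K$ of $\{1,\dots,n\}$ of cardinality $r$, $c^{(n)}(I,J,K):=c_{\lambda,\mu}^{\nu}$, the usual Littlewood–Richardson coefficient (the multiplicity of the irreducible $GL(r,\mathbb C)$-representation $V_\nu$ of highest weight $\nu$ in $V_\lambda\otimes V_\mu$), where $\lambda=\rho_r(\sigma_n(I))$, $\mu=\rho_r(\sigma_n(J))$, $\nu=\rho_r(K)$. 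*)

(* Defs.v *)
From HB Require Import structures.
From mathcomp Require Import all_boot all_order all_algebra finmap.
From mathcomp Require Import complex mxtens.
From mathcomp.multinomials Require Import mpoly.
From mathcomp Require Import boolp classical_sets reals.
From mathcomp Require Import zify.

Set Implicit Arguments.
Unset Strict Implicit.
Unset Printing Implicit Defensive.

Import Order.TTheory GRing.Theory Num.Theory.

Local Open Scope fset_scope.
Local Open Scope ring_scope.

(* Subsets of {1, ..., n} are finite sets of natural numbers. *)

Definition rsubset (n r : nat) (I : {fset nat}) : Prop :=
  #|` I| = r /\ (forall i, i \in I -> 0 < i <= n)%N.

(* [elt I p] is i_p for I = {i_1 < ... < i_r} and 1 <= p <= r; moreover
   [elt I 0] is 0, which is the convention i_0 = 0. *)
Definition elt (I : {fset nat}) (p : nat) : nat :=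
  nth 0%N (0%N :: sort leq (enum_fset I)) p.

Definition sigma (n : nat) (I : {fset nat}) : {fset nat} :=
  [fset (n.+1 - i)%N | i in I].

Section HornSets.
Local Open Scope nat_scope.

Definition hornU (n r : nat) (I J K : {fset nat}) : Prop :=
  [/\ rsubset n r I, rsubset n r J, rsubset n r K &
      \sum_(i <- I) i + \sum_(j <- J) j = \sum_(k <- K) k + (r * r.+1) %/ 2].

(* The recursion defining T^n_r is on r; [m] only bounds its depth, and any
   m >= r.-1 gives the same set (see [hornT_rec]). *)
Fixpoint hornT_depth (m n r : nat) (I J K : {fset nat}) : Prop :=
  hornU n r I J K /\
  if m is m'.+1 then
    forall (p : nat) (F G H : {fset nat}),
      0 < p < r -> hornT_depth m' r p F G H ->
      \sum_(f <- F) elt I f + \sum_(g <- G) elt J g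
        <= \sum_(h <- H) elt K h + (p * p.+1) %/ 2
  else True.

Definition hornT (n r : nat) (I J K : {fset nat}) : Prop :=
  hornT_depth r n r I J K.

Lemma hornT_depthE (m1 m2 n r : nat) (I J K : {fset nat}) :
  r.-1 <= m1 -> r.-1 <= m2 ->
  hornT_depth m1 n r I J K <-> hornT_depth m2 n r I J K.
Proof.
have depth m p q : q.-1 <= m.+1 -> 0 < p < q -> p.-1 <= m by lia.
elim: m1 m2 n r I J K => [|m1 IH] [|m2] n r I J K h1 h2 //=;
  split=> -[hU hT]; split=> // p F G H hp hF; try by exfalso; lia.
all: apply: (hT p) => //.
all: by apply/(IH m2 r p F G H (depth _ _ _ h1 hp) (depth _ _ _ h2 hp)).
Qed.

Lemma hornT_rec (n r : nat) (I J K : {fset nat}) :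
  hornT n r I J K <->
  hornU n r I J K /\
  forall (p : nat) (F G H : {fset nat}),
    0 < p < r -> hornT r p F G H ->
    \sum_(f <- F) elt I f + \sum_(g <- G) elt J g
      <= \sum_(h <- H) elt K h + (p * p.+1) %/ 2.
Proof.
rewrite /hornT; case: r => [|r] /=.
  by split=> [[hU _]|[hU _]]; split=> // p F G H; rewrite ltn0 andbF.
have depthE p F G H : 0 < p < r.+1 ->
    hornT_depth r r.+1 p F G H <-> hornT_depth p r.+1 p F G H.
  by move=> hp; apply: hornT_depthE; lia.
by split=> -[hU hT]; split=> // p F G H hp hF; apply: (hT p) => //;
  apply/depthE.
Qed.

Definition hornTtilde (n r : nat) (I J K : {fset nat}) : Prop :=
  exists I' J' : {fset nat},
    [/\ hornT n r I' J' K, I = sigma n I' & J = sigma n J'].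

End HornSets.

Section Representations.
Variables (C : fieldType) (r : nat).

(* A d-dimensional representation of GL(r, C) is given by a function on r x r
   matrices; its values outside the invertible matrices are irrelevant. *)

(* Matrix coefficients are regular functions on GL(r, C), i.e. polynomials in
   the entries of g divided by a power of det g. *)
Definition rational_rep (d : nat) (V : 'M[C]_r -> 'M[C]_d) : Prop :=
  [/\ V 1%:M = 1%:M,
      forall g h, g \in unitmx -> h \in unitmx -> V (g *m h) = V g *m V h &
      forall i j, exists (k : nat) (P : {mpoly C[r * r]}),
        forall g, g \in unitmx ->
          V g i j = P.@[fun l => mxvec g 0 l] / \det g ^+ k].

Definition irreducible_rep (d : nat) (V : 'M[C]_r -> 'M[C]_d) : Prop :=
  (0 < d)%N /\
  forall U : {vspace 'cV[C]_d},
    (forall g v, g \in unitmx -> v \in U -> V g *m v \in U) ->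
    U = 0%VS \/ U = fullv.

(* Highest weight with respect to the Borel subgroup of upper triangular
   matrices and its torus of diagonal matrices. *)
Definition highest_weight_vector (d : nat) (V : 'M[C]_r -> 'M[C]_d)
    (lambda : 'I_r -> nat) (v : 'cV[C]_d) : Prop :=
  [/\ v != 0,
      forall t : 'rV[C]_r, (forall i, t 0 i != 0) ->
        V (diag_mx t) *m v = (\prod_i t 0 i ^+ lambda i) *: v &
      forall g : 'M[C]_r, is_trig_mx g^T -> (forall i, g i i = 1) ->
        V g *m v = v].

Definition irrep_of_weight (lambda : 'I_r -> nat) (d : nat)
    (V : 'M[C]_r -> 'M[C]_d) : Prop :=
  [/\ rational_rep V, irreducible_rep V &
      exists v, highest_weight_vector V lambda v].

Definition tensor_rep (d1 d2 : nat) (V : 'M[C]_r -> 'M[C]_d1)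
    (W : 'M[C]_r -> 'M[C]_d2) (g : 'M[C]_r) : 'M[C]_(d1 * d2) :=
  V g *t W g.

(* [multiplicity V W c]: dim Hom_GL(V, W) = c.  For V irreducible this is the
   multiplicity of V in W (C will be the complex numbers). *)
Definition multiplicity (d1 d2 : nat) (V : 'M[C]_r -> 'M[C]_d1)
    (W : 'M[C]_r -> 'M[C]_d2) (c : nat) : Prop :=
  exists U : {vspace 'M[C]_(d2, d1)},
    (forall A, A \in U <-> (forall g, g \in unitmx -> A *m V g = W g *m A)) /\
    \dim U = c.

(* Since an irreducible representation is determined up to isomorphism by its
   highest weight, exactly one natural number c qualifies when lambda, mu and
   nu are weakly decreasing; [xget] selects it. *)
Definition LRcoef (lambda mu nu : 'I_r -> nat) : nat :=
  xget 0%N [set c : nat |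
    exists (d1 d2 d3 : nat) (V1 : 'M[C]_r -> 'M[C]_d1)
           (V2 : 'M[C]_r -> 'M[C]_d2) (V3 : 'M[C]_r -> 'M[C]_d3),
      [/\ irrep_of_weight lambda V1, irrep_of_weight mu V2,
          irrep_of_weight nu V3 & multiplicity V3 (tensor_rep V1 V2) c]]%classic.

End Representations.

(* The entries i_r - r, ..., i_1 - 1, listed by 0 <= a < r. *)
Definition rho (r : nat) (I : {fset nat}) : 'I_r -> nat :=
  fun a => (elt I (r - a) - (r - a))%N.

Definition horn_LRcoef (R : realType) (n r : nat) (I J K : {fset nat}) : nat :=
  @LRcoef R[i] r (@rho r (sigma n I)) (@rho r (sigma n J)) (@rho r K).

(* The set of the i_p for 1 <= p <= u and the i_p - 1 for u < p <= r. *)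
Definition reduced (r u : nat) (I : {fset nat}) : {fset nat} :=
  [fset (if (p <= u)%N then elt I p else (elt I p).-1) | p in iota 1 r].

(* Main.v *)
From HB Require Import structures.
Require Import Defs.
From mathcomp Require Import all_boot all_order all_algebra finmap.
From mathcomp Require Import complex mxtens.
From mathcomp.multinomials Require Import mpoly.
From mathcomp Require Import boolp reals.
From mathcomp Require Import zify ring.

(* By the Borel-Weil construction, the coefficient for (lambda, mu, nu) is the dimension
   of the space of polynomials F(g1, g2) in two r x r matrices which are semi-invariant
   of weights lambda and mu under lower triangular matrices acting on the left on g1 and
   on g2, and of weight nu under upper triangular matrices acting on the right on both.
   Complete reducibility enters only through a contravariant Hermitian form, which every
   irreducible representation inherits from the Fischer product of polynomials.

   Passing from (I, J, K) to the reduced sets subtracts (1^u), (1^v) and (1^(u+v)) from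
   lambda, mu and nu.  Let D(g1, g2) be the minor formed by the first u rows of g1 and
   the first v rows of g2 in the first u+v columns.  Multiplication by D embeds the
   semi-invariants of the reduced weights into those of weights (lambda, mu, nu).
   Condition (e) reads lambda_u + mu_v > (n - r) + nu_(u+v+1) >= nu_1 + nu_(u+v+1); by a
   degree count it forces every semi-invariant of weights (lambda, mu, nu) to vanish
   where D does.  A polynomial vanishing on the zeros of a generic determinant is
   divisible by it, so the embedding is onto. *)

Set Implicit Arguments.
Unset Strict Implicit.
Unset Printing Implicit Defensive.

Import Order.TTheory GRing.Theory Num.Theory.
Local Open Scope ring_scope.

(** * Polynomial functions *)

(** [LRcoef] selects an element of a set of natural numbers, and the two sets are shown to be equal.
    This takes an irreducible representation of every dominant weight and an equality of Hom
    dimensions for arbitrary realisations, so each given irreducible has to be identified with a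
    concrete space of semi-invariants. The obstacle is that its matrix coefficients are only
    rational: a power of the determinant is cleared by shifting the weight, then divided out again
    by irreducibility of the space of the shifted weight. Semi-invariants are polynomials on all
    matrices, singular ones included: for u = r the minor D is det g1, whose zeros all lie outside
    the group. The weights of D come from the order reversals: lambda_a = n - r + a - i_a, whereas
    nu_a = k_(r+1-a) - (r+1-a). Lowering n and the i_p with p > u by one costs the first u parts of
    lambda; lowering the k_p with p > w costs the first r - w = u + v parts of nu. *)

Section PolynomialFunctions.
Variable K : numFieldType.

(** Generated by linear forms instead of monomials, the notion applies to matrices and pairs of
    matrices alike, without coordinates, and supports induction on the derivation. *)
Inductive polyfun (T : lmodType K) : (T -> K) -> Prop :=
| polyfun_cst c : polyfun (fun=> c)
| polyfun_lin (l : {linear T -> K^o}) : polyfun l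
| polyfunD f g : polyfun f -> polyfun g -> polyfun (fun x => f x + g x)
| polyfunM f g : polyfun f -> polyfun g -> polyfun (fun x => f x * g x).

Lemma polyfun_ext (T : lmodType K) (f g : T -> K) :
  polyfun f -> f =1 g -> polyfun g.
Proof. by move=> pf /funext <-. Qed.

Lemma polyfun_linear (T : lmodType K) (l : T -> K) :
  (forall a x y, l (a *: x + y) = a * l x + l y) -> polyfun l.
Proof.
move=> hl; pose L := GRing.isLinear.Build _ _ _ _ (l : T -> K^o) hl.
pose l' : {linear T -> K^o} := HB.pack (l : T -> K^o) L.
exact: (polyfun_lin l').
Qed.

Lemma polyfunN (T : lmodType K) (f : T -> K) :
  polyfun f -> polyfun (fun x => - f x).
Proof.
move=> pf; apply: polyfun_ext (polyfunM (polyfun_cst T (-1)) pf) _ => x.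
by rewrite mulN1r.
Qed.

Lemma polyfunB (T : lmodType K) (f g : T -> K) :
  polyfun f -> polyfun g -> polyfun (fun x => f x - g x).
Proof. by move=> pf pg; apply: polyfunD pf (polyfunN pg). Qed.

Lemma polyfunX (T : lmodType K) (f : T -> K) k :
  polyfun f -> polyfun (fun x => f x ^+ k).
Proof.
move=> pf; elim: k => [|k IH]; first exact: polyfun_cst.
by apply: polyfun_ext (polyfunM pf IH) _ => x; rewrite exprS.
Qed.

Lemma polyfun_sum (T : lmodType K) (I : Type) (s : seq I) (P : pred I)
    (F : I -> T -> K) :
  (forall i, polyfun (F i)) -> polyfun (fun x => \sum_(i <- s | P i) F i x).
Proof.
move=> pF; elim: s => [|i s IH].
  by apply: polyfun_ext (polyfun_cst T 0) _ => x; rewrite big_nil.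
case Pi: (P i); last by apply: polyfun_ext IH _ => x; rewrite big_cons Pi.
by apply: polyfun_ext (polyfunD (pF i) IH) _ => x; rewrite big_cons Pi.
Qed.

Lemma polyfun_prod (T : lmodType K) (I : Type) (s : seq I) (P : pred I)
    (F : I -> T -> K) :
  (forall i, polyfun (F i)) -> polyfun (fun x => \prod_(i <- s | P i) F i x).
Proof.
move=> pF; elim: s => [|i s IH].
  by apply: polyfun_ext (polyfun_cst T 1) _ => x; rewrite big_nil.
case Pi: (P i); last by apply: polyfun_ext IH _ => x; rewrite big_cons Pi.
by apply: polyfun_ext (polyfunM (pF i) IH) _ => x; rewrite big_cons Pi.
Qed.

Lemma polyfun_det (T : lmodType K) n (X : T -> 'M[K]_n) :
  (forall i j, polyfun (fun x => X x i j)) -> polyfun (fun x => \det (X x)).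
Proof.
move=> pX; apply: polyfun_sum => s; apply: polyfunM; first exact: polyfun_cst.
by apply: polyfun_prod => i; apply: pX.
Qed.

Lemma polyfun_comp (T T' : lmodType K) (h : T' -> T) (f : T -> K) :
  (forall l : {linear T -> K^o}, polyfun (fun x => l (h x))) ->
  polyfun f -> polyfun (fun x => f (h x)).
Proof.
move=> ph; elim=> [c|l|f1 f2 _ p1 _ p2|f1 f2 _ p1 _ p2].
- exact: polyfun_cst.
- exact: ph.
- exact: polyfunD.
- exact: polyfunM.
Qed.

Lemma polyfun_coef m n i j : polyfun (fun x : 'M[K]_(m, n) => x i j).
Proof. by apply: polyfun_linear => a x y; rewrite !mxE. Qed.

Lemma linear_mxE m n (l : {linear 'M[K]_(m, n) -> K^o}) x :
  l x = \sum_i \sum_j x i j * l (delta_mx i j).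
Proof.
rewrite {1}[x]matrix_sum_delta linear_sum; apply: eq_bigr => i _.
rewrite linear_sum; apply: eq_bigr => j _.
by rewrite linearZ.
Qed.

Lemma polyfun_mx (T : lmodType K) m n (h : T -> 'M[K]_(m, n)) f :
  (forall i j, polyfun (fun x => h x i j)) -> polyfun f ->
  polyfun (fun x => f (h x)).
Proof.
move=> ph; apply: polyfun_comp => l.
apply: (@polyfun_ext _ (fun x => \sum_i \sum_j h x i j * l (delta_mx i j))).
  apply: polyfun_sum => i; apply: polyfun_sum => j.
  by apply: polyfunM; [exact: ph | exact: polyfun_cst].
by move=> x; rewrite [RHS]linear_mxE.
Qed.

Lemma polyfun_pair (T : lmodType K) m n m' n' (h1 : T -> 'M[K]_(m, n))
    (h2 : T -> 'M[K]_(m', n')) (f : 'M[K]_(m, n) * 'M[K]_(m', n') -> K) :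
  (forall i j, polyfun (fun x => h1 x i j)) ->
  (forall i j, polyfun (fun x => h2 x i j)) ->
  polyfun f -> polyfun (fun x => f (h1 x, h2 x)).
Proof.
move=> p1 p2; apply: polyfun_comp => l.
have l1 a x y : l (a *: x + y, 0) = a * l (x, 0) + l (y, 0).
  rewrite -[X in X * _]/(a) -[_ * l _]/(a *: l (x, 0)) -linearP; congr (l _).
  by congr pair; rewrite /= scaler0 addr0.
have l2 a x y : l (0, a *: x + y) = a * l (0, x) + l (0, y).
  rewrite -[_ * l _]/(a *: l (0, x)) -linearP; congr (l _).
  by congr pair; rewrite /= scaler0 addr0.
have pl1 := polyfun_linear (l := fun x => l (x, 0)) l1.
have pl2 := polyfun_linear (l := fun x => l (0, x)) l2.
apply: (polyfun_ext (polyfunD (polyfun_mx p1 pl1) (polyfun_mx p2 pl2))) => x.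
have -> : (h1 x, h2 x) = (h1 x, 0) + (0, h2 x).
  by congr pair; rewrite /= (addr0, add0r).
by rewrite linearD.
Qed.

Lemma polyfun_line (T : lmodType K) (f : T -> K) x z :
  polyfun f -> exists p : {poly K}, forall t, f (x + t *: z) = p.[t].
Proof.
elim=> [c|l|f1 f2 _ [p1 h1] _ [p2 h2]|f1 f2 _ [p1 h1] _ [p2 h2]].
- by exists c%:P => t; rewrite hornerC.
- exists ((l x)%:P + (l z)%:P * 'X) => t.
  by rewrite linearD linearZ !hornerE mulrC.
- by exists (p1 + p2) => t; rewrite hornerD h1 h2.
- by exists (p1 * p2) => t; rewrite hornerM h1 h2.
Qed.

Lemma poly_eq0_nat (p : {poly K}) :
  (forall k : nat, p.[k%:R] = 0) -> p = 0.
Proof.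
move=> hp; apply/eqP/contraT => p0.
have := max_poly_roots (rs := [seq k%:R | k <- iota 0 (size p)]) p0.
rewrite size_map size_iota ltnn; apply.
  by apply/allP => _ /mapP[k _ ->]; rewrite rootE hp.
by rewrite map_inj_uniq ?iota_uniq // => a b /eqP; rewrite eqr_nat => /eqP.
Qed.

(** On the line both functions are univariate polynomials, and that of [g] is nonzero at [t = 1], so
    that of [f] is zero. Since the product is only asked to vanish on the line, this applies inside
    the zero set of a third function. *)
Lemma polyfun_line_idomain (T : lmodType K) (f g : T -> K) x z :
  polyfun f -> polyfun g ->
  (forall t, f (x + t *: z) * g (x + t *: z) = 0) -> g (x + z) != 0 ->
  f x = 0.
Proof.
move=> pf pg fg gz.
have [p hp] := polyfun_line x z pf; have [q hq] := polyfun_line x z pg.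
have pq : p * q = 0.
  by apply: poly_eq0_nat => k; rewrite hornerM -hp -hq fg.
have q0 : q != 0.
  apply: contraNneq gz => q0; have := hq 1.
  by rewrite q0 horner0 scale1r => ->.
move/eqP: pq; rewrite mulf_eq0 (negPf q0) orbF => /eqP p0.
by have := hp 0; rewrite p0 horner0 scale0r addr0.
Qed.

Lemma polyfun_idomain (T : lmodType K) (f g : T -> K) z :
  polyfun f -> polyfun g -> (forall x, f x * g x = 0) -> g z != 0 ->
  forall x, f x = 0.
Proof.
move=> pf pg fg gz x; apply: (@polyfun_line_idomain _ f g x (z - x)) => //.
by rewrite addrC subrK.
Qed.

Lemma polyfun_eq (T : lmodType K) (f1 f2 g : T -> K) z :
  polyfun f1 -> polyfun f2 -> polyfun g ->
  (forall x, g x != 0 -> f1 x = f2 x) -> g z != 0 -> f1 =1 f2.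
Proof.
move=> p1 p2 pg h gz x; apply/eqP; rewrite -subr_eq0; apply/eqP.
apply: (polyfun_idomain (polyfunB p1 p2) pg _ gz) => {}x.
by have [->|/h ->] := eqVneq (g x) 0; rewrite ?mulr0 // subrr mul0r.
Qed.

(* If f * det vanishes where the corner minor does, then so does f: look at f on such
   a line. *)
Lemma singular_corner_line n (A : 'M[K]_(1 + n)) : \det (drsubmx A) = 0 ->
  exists Z : 'M[K]_(1 + n),
    (forall t, \det (drsubmx (A + t *: Z)) = 0) /\ \det (A + Z) != 0.
Proof.
case: n A => [|n] A; first by rewrite det_mx00 => /eqP; rewrite oner_eq0.
set B := drsubmx A => B0.
have rB : (\rank B <= n)%N.
  rewrite -ltnS ltn_neqAle rank_leq_row andbT; apply: contra_eq_neq B0 => /eqP rB.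
  by rewrite -unitfE -unitmxE -row_full_unit /row_full rB.
pose L := col_ebase B; pose R := row_ebase B.
have defB : B = L *m pid_mx (\rank B) *m R by rewrite mulmx_ebase.
have uL : L \in unitmx := col_ebase_unit B.
have uR : R \in unitmx := row_ebase_unit B.
(* [W] is the permutation matrix exchanging the first and the last index: invertible, while the last
   row of its corner [pid_mx n] is zero. In the bases that reduce [B] to [pid_mx (\rank B)], all
   corners on the line from [A] to [Y] share this zero row. *)
pose e : 'rV[K]_n.+1 := delta_mx 0 ord_max.
pose W : 'M[K]_(1 + n.+1) := block_mx 0 e e^T (pid_mx n).
pose Y := block_mx 1%:M 0 0 L *m W *m block_mx 1%:M 0 0 R.
exists (Y - A); split=> [t|].
  have -> : drsubmx (A + t *: (Y - A)) =
      L *m ((1 - t) *: pid_mx (\rank B) + t *: pid_mx n) *m R.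
    have -> : A + t *: (Y - A) = (1 - t) *: A + t *: Y.
      by rewrite scalerBr scalerBl scale1r [t *: Y - _]addrC addrA.
    have dY : drsubmx Y = L *m pid_mx n *m R.
      rewrite /Y /W !mulmx_block block_mxKdr.
      by rewrite !(mul0mx, mulmx0, mul1mx, mulmx1, add0r, addr0).
    have -> : drsubmx ((1 - t) *: A + t *: Y) = (1 - t) *: B + t *: drsubmx Y.
      by apply/matrixP => i j; rewrite !mxE.
    by rewrite dY {1}defB mulmxDr mulmxDl -!scalemxAr -!scalemxAl.
  rewrite !det_mulmx.
  suff -> : \det ((1 - t) *: pid_mx (\rank B) + t *: pid_mx n : 'M[K]_n.+1) = 0.
    by rewrite mulr0 mul0r.
  rewrite (expand_det_row _ ord_max) big1 // => j _.
  by rewrite !mxE /= ltnn ltnNge rB !andbF !mulr0 addr0 mul0r.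
rewrite addrC subrK !det_mulmx !det_ublock !det1 !mul1r.
rewrite !mulf_eq0 !negb_or -!unitfE -!unitmxE uL uR andbT /=.
suff : W *m W = 1%:M by case/mulmx1_unit.
rewrite /W mulmx_block !(mul0mx, mulmx0, add0r).
have ee : e *m e^T = 1%:M.
  by rewrite /e trmx_delta mul_delta_mx; apply/matrixP => i j; rewrite !ord1 !mxE !eqxx.
pose P : 'M[K]_n.+1 := pid_mx n.
have ep : e *m P = 0.
  apply/matrixP => i j; rewrite -rowE !mxE /= ltnn andbF //.
have pe : P *m e^T = 0.
  by apply: trmx_inj; rewrite trmx_mul trmxK tr_pid_mx ep trmx0.
have eep : e^T *m e + P *m P = 1%:M.
  rewrite /e trmx_delta mul_delta_mx pid_mx_id //.
  apply/matrixP => i j; rewrite !mxE -!val_eqE /=.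
  have := ltn_ord i; have := ltn_ord j.
  case: (ltngtP i n) => hi; case: (ltngtP j n) => hj; case: eqP => // hij;
    rewrite ?addr0 ?add0r //; lia.
by rewrite ee ep pe eep -scalar_mx_block.
Qed.

End PolynomialFunctions.

(** * Divisibility by a generic determinant *)

Section DeterminantalDivisibility.
Variable K : numFieldType.

(* Induction on n.  Let M be the corner minor and e the entry (0, 0), so that
   det = M e + N.  Eliminating e gives M^k F = Q det + R with R independent of e; as e
   can be chosen with det = 0 where M <> 0, M R = 0.  Then Q vanishes where M does,
   and M divides Q by induction. *)
Lemma polyfun_dvd_det n (T : lmodType K) (X : T -> 'M[K]_n) (s : 'M[K]_n -> T)
    (F : T -> K) :
  (forall a x y, X (a *: x + y) = a *: X x + X y) ->
  (forall a x y, s (a *: x + y) = a *: s x + s y) ->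
  (forall A, X (s A) = A) ->
  polyfun F -> (forall x, \det (X x) = 0 -> F x = 0) ->
  exists Q : T -> K, polyfun Q /\ forall x, F x = \det (X x) * Q x.
Proof.
(* The induction hypothesis will be used on the same [T], with [X] replaced by its corner block and
   [s] by extension by zero; this is why [X] is any linear map with a linear section. *)
elim: n T X s F => [|n IH] T X s F linX lins Xs pF F0.
  by exists F; split=> // x; rewrite det_mx00 mul1r.
pose Y : T -> 'M[K]_(1 + n) := X.
have XE a x y : Y (x + a *: y) = Y x + a *: Y y.
  by rewrite addrC /Y linX addrC.
pose E := s (delta_mx 0 0 : 'M[K]_(1 + n)).
have YE : Y E = delta_mx 0 0 by exact: Xs.
pose e x := Y x 0 0.
pose M x := \det (drsubmx (Y x)).
(* [sh] projects onto the hyperplane [e = 0] along [E], so a function composed with [sh] is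
   independent of the entry [e]. *)
pose sh x := x - e x *: E.
have pY i j : polyfun (fun x => Y x i j).
  by apply: polyfun_linear => a x y; rewrite /Y linX !mxE.
have pM : polyfun M.
  apply: polyfun_det => i j; apply: polyfun_ext (pY (rshift 1 i) (rshift 1 j)) _.
  by move=> x; rewrite !mxE.
have pdet : polyfun (fun x => \det (Y x)) by exact: polyfun_det.
have Mt x t : M (x + t *: E) = M x.
  rewrite /M XE YE; congr (\det _); apply/matrixP => i j; rewrite !mxE /=.
  by rewrite mulr0 addr0.
have et x t : e (x + t *: E) = e x + t.
  by rewrite /e XE YE !mxE !eqxx mulr1.
have sht x t : sh (x + t *: E) = sh x.
  by rewrite /sh et scalerDl opprD addrACA subrr addr0.
have detE x : \det (Y x) = M x * e x + \det (Y (sh x)).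
  have YshE : Y (sh x) = Y x - e x *: delta_mx 0 0.
    by rewrite /sh -scaleNr XE YE scaleNr.
  have cofE j : cofactor (Y (sh x)) 0 j = cofactor (Y x) 0 j.
    congr (_ * \det _); apply/matrixP => i k; rewrite YshE !mxE.
    by rewrite -val_eqE /= mulr0 subr0.
  rewrite !(expand_det_row _ 0) !(bigD1 (0 : 'I_(1 + n)) isT) /=.
  have -> : Y (sh x) 0 0 = 0 by rewrite YshE !mxE !eqxx mulr1 subrr.
  rewrite mul0r add0r; congr (_ + _).
    rewrite mulrC; congr (_ * _); rewrite /cofactor addn0 expr0 mul1r.
    congr (\det _); apply/matrixP => i j; rewrite !mxE.
    by congr (Y x _ _); apply: val_inj.
  apply: eq_bigr => j j0; rewrite cofE YshE !mxE (negPf j0) andbF.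
  by rewrite mulr0 subr0.
have plsh f : polyfun f -> polyfun (fun x => f (sh x)).
  apply: polyfun_comp => l.
  apply: (polyfun_ext
    (polyfunB (polyfun_lin l) (polyfunM (pY 0 0) (polyfun_cst T (l E))))) => x.
  by rewrite linearB linearZ.
have [k [Q [R [pQ [pR [Rt FE]]]]]] : exists k Q R, polyfun Q /\ polyfun R /\
    (forall x t, R (x + t *: E) = R x) /\
    (forall x, M x ^+ k * F x = Q x * \det (Y x) + R x).
  elim: {F0} pF => [c|l|f1 f2 _ [k1 [Q1 [R1 [pQ1 [pR1 [Rt1 E1]]]]]]
                     _ [k2 [Q2 [R2 [pQ2 [pR2 [Rt2 E2]]]]]]
                   |f1 f2 _ [k1 [Q1 [R1 [pQ1 [pR1 [Rt1 E1]]]]]]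
                     _ [k2 [Q2 [R2 [pQ2 [pR2 [Rt2 E2]]]]]]].
  - exists 0%N, (fun=> 0), (fun=> c); split; first exact: polyfun_cst.
    split; first exact: polyfun_cst.
    by split=> // x; rewrite expr0 mul1r mul0r add0r.
  (* Multiply [l x = l (sh x) + e x * l E] by [M x] and replace [M x * e x] by
     [\det (Y x) - \det (Y (sh x))]. *)
  - exists 1%N, (fun=> l E), (fun x => M x * l (sh x) - l E * \det (Y (sh x))).
    split; first exact: polyfun_cst.
    split.
      apply: polyfunB; apply: polyfunM => //; first exact: plsh (polyfun_lin l).
        exact: polyfun_cst.
      exact: plsh pdet.
    split=> x; first by move=> t; rewrite Mt sht.
    rewrite detE expr1.
    have -> : l x = l (sh x) + e x * l E.
      by rewrite /sh linearB linearZ /= subrK.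
    by ring.
  - exists (k1 + k2)%N, (fun x => M x ^+ k2 * Q1 x + M x ^+ k1 * Q2 x),
      (fun x => M x ^+ k2 * R1 x + M x ^+ k1 * R2 x).
    split; first by apply: polyfunD; apply: polyfunM => //; exact: polyfunX.
    split; first by apply: polyfunD; apply: polyfunM => //; exact: polyfunX.
    split=> x; first by move=> t; rewrite Mt Rt1 Rt2.
    rewrite exprD.
    transitivity (M x ^+ k2 * (M x ^+ k1 * f1 x) + M x ^+ k1 * (M x ^+ k2 * f2 x)).
      by ring.
    by rewrite E1 E2; ring.
  - exists (k1 + k2)%N,
      (fun x => Q1 x * Q2 x * \det (Y x) + Q1 x * R2 x + R1 x * Q2 x),
      (fun x => R1 x * R2 x).
    split; first by do 3?[apply: polyfunD | apply: polyfunM] => //; exact: polyfunM.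
    split; first exact: polyfunM.
    split=> x; first by move=> t; rewrite Rt1 Rt2.
    rewrite exprD.
    transitivity ((M x ^+ k1 * f1 x) * (M x ^+ k2 * f2 x)); first by ring.
    by rewrite E1 E2; ring.
have RM x : M x * R x = 0.
  have [->|Mx] := eqVneq (M x) 0; first by rewrite mul0r.
  pose t := - (\det (Y x) / M x).
  have d0 : \det (Y (x + t *: E)) = 0.
    rewrite detE Mt et sht mulrDr addrAC -detE /t mulrN mulrCA divff //.
    by rewrite mulr1 subrr.
  have := FE (x + t *: E).
  by rewrite F0 // d0 !mulr0 add0r Rt => <-; rewrite mulr0.
have {FE} FE x : M x ^+ k.+1 * F x = (M x * Q x) * \det (Y x).
  by rewrite exprS -mulrA FE mulrDr RM addr0 mulrA.
have {Q pQ R pR Rt RM} [Q [pQ {}FE]] : exists Q, polyfun Q /\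
    forall x, M x ^+ k.+1 * F x = Q x * \det (Y x).
  by exists (fun x => M x * Q x); split=> //; exact: polyfunM.
have M1 : M (s 1%:M) != 0.
  rewrite /M /Y Xs; suff -> : drsubmx (1%:M : 'M[K]_(1 + n)) = 1%:M.
    by rewrite det1 oner_eq0.
  by apply/matrixP => i j; rewrite !mxE.
elim: {k} k.+1 Q pQ FE => [|k IHk] Q pQ FE.
  by exists Q; split=> // x; rewrite -[F x]mul1r -(expr0 (M x)) FE mulrC.
have [Q1 [pQ1 QE]] : exists Q1, polyfun Q1 /\ forall x, Q x = M x * Q1 x.
  apply: (IH T (fun x => drsubmx (Y x))
      (fun A => s (block_mx 0 0 0 A : 'M[K]_(1 + n)))) => //.
  - by move=> a x y; rewrite /Y linX; apply/matrixP => i j; rewrite !mxE.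
  - move=> a A B; rewrite -lins; congr s.
    have -> // : block_mx 0 0 0 (a *: A + B) =
        a *: block_mx 0 0 0 A + block_mx 0 0 0 B :> 'M[K]_(1 + n).
    by rewrite scale_block_mx add_block_mx !scaler0 !addr0.
  - by move=> A; rewrite /Y Xs block_mxKdr.
  (* [M] vanishes on the whole line, hence so does [Q] times the determinant, by [FE]; but the
     determinant is nonzero at the far end. *)
  move=> x Mx0; have [Z [Z1 Z2]] := singular_corner_line Mx0.
  apply: (@polyfun_line_idomain _ _ _ _ x (s Z) pQ pdet) => [t|].
    by rewrite -FE exprS /M XE {2}/Y Xs Z1 !mul0r.
  by rewrite -(scale1r (s Z)) XE scale1r {2}/Y Xs.
apply: (IHk Q1 pQ1) => x; apply/eqP; rewrite -subr_eq0; apply/eqP.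
move: x; apply: (@polyfun_idomain _ _ _ M _ _ pM _ M1) => [|x].
  apply: polyfunB; apply: polyfunM => //; exact: polyfunX.
rewrite mulrBl -[_ * M x]mulrC mulrA -exprS FE QE; ring.
Qed.
End DeterminantalDivisibility.

(** * Semi-invariants of pairs of matrices *)

Section Vanishing.
Variables (K : numFieldType) (r : nat).
Implicit Types (lambda mu nu : 'I_r -> nat) (b g : 'M[K]_r).

(** The opposite Borel subgroup appears throughout as [low_tri b^T]. *)
Definition low_tri b := is_trig_mx b /\ forall i, b i i != 0.

Definition tri_char lambda b := \prod_i b i i ^+ lambda i.

Definition semi_inv2 lambda mu nu (F : 'M[K]_r * 'M[K]_r -> K) :=
  polyfun F /\ forall b1 b2 b g1 g2,
    low_tri b1 -> low_tri b2 -> low_tri b^T ->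
    F (b1 *m g1 *m b, b2 *m g2 *m b)
    = tri_char lambda b1 * tri_char mu b2 * tri_char nu b * F (g1, g2).

Lemma tri_char_neq0 lambda b : (forall i, b i i != 0) -> tri_char lambda b != 0.
Proof. by move=> hb; apply/prodf_neq0 => i _; apply: expf_neq0. Qed.

Lemma low_tri1 : low_tri 1%:M.
Proof.
split; first exact: scalar_mx_is_trig.
by move=> i; rewrite mxE eqxx oner_eq0.
Qed.

Lemma low_tri_mulE b b' i : low_tri b -> low_tri b' ->
  (b *m b') i i = b i i * b' i i.
Proof.
move=> [/is_trig_mxP tb _] [/is_trig_mxP tb' _].
rewrite mxE (bigD1 i) //= big1 ?addr0 // => j ji.
have [ij|jj|] := ltngtP i j; first by rewrite tb // mul0r.
  by rewrite tb' // mulr0.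
by move/val_inj => e; rewrite e eqxx in ji.
Qed.

Lemma low_tri_mul b b' : low_tri b -> low_tri b' -> low_tri (b *m b').
Proof.
move=> hb hb'; split=> [|i]; last first.
  by rewrite low_tri_mulE // mulf_neq0 //; [case: hb|case: hb'].
case: hb hb' => /is_trig_mxP tb _ [/is_trig_mxP tb' _].
apply/is_trig_mxP => i j ij; rewrite mxE big1 // => k _.
have [ik|ki] := ltnP i k; first by rewrite tb // mul0r.
by rewrite tb' ?mulr0 // (leq_ltn_trans ki).
Qed.

Lemma tri_char1 lambda : tri_char lambda 1%:M = 1.
Proof. by apply: big1 => i _; rewrite mxE eqxx expr1n. Qed.

Lemma low_tri_diag (d : 'rV[K]_r) : (forall i, d 0 i != 0) -> low_tri (diag_mx d).
Proof.
move=> hd; split=> [|i]; first exact: diag_mx_is_trig.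
by rewrite mxE eqxx mulr1n.
Qed.

Lemma tri_char_diag lambda (d : 'rV[K]_r) :
  tri_char lambda (diag_mx d) = \prod_i d 0 i ^+ lambda i.
Proof. by apply: eq_bigr => i _; rewrite mxE eqxx. Qed.

(* Homogeneity: F has degree lambda_a in row a of g1, mu_b in row b of g2 and nu_j in
   the j-th columns of (g1, g2) together; too many factors would come from the
   columns in S. *)
Lemma semi_inv2_support lambda mu nu F (A B S : {set 'I_r}) g1 g2 :
  semi_inv2 lambda mu nu F ->
  (forall i j, i \in A -> j \notin S -> g1 i j = 0) ->
  (forall i j, i \in B -> j \notin S -> g2 i j = 0) ->
  (\sum_(j in S) nu j < \sum_(i in A) lambda i + \sum_(i in B) mu i)%N ->
  F (g1, g2) = 0.
Proof.
move=> [pF hF] gA gB lt.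
pose base (E : {set 'I_r}) g : 'M[K]_r :=
  \matrix_(i, j) (if (i \in E) || (j \notin S) then g i j else 0).
pose dir (E : {set 'I_r}) g : 'M[K]_r :=
  \matrix_(i, j) (if (i \in E) || (j \notin S) then 0 else g i j).
have [p hp] := polyfun_line (base A g1, base B g2) (dir A g1, dir B g2) pF.
(* Rows in [E] are divided by [t], columns in [S] multiplied by it. A pole could only arise in a row
   of [E] and a column outside [S], where the entries are zero; so the scaled matrix is affine in
   [t]. *)
have scale (E : {set 'I_r}) g (t : K) : t != 0 ->
    (forall i j, i \in E -> j \notin S -> g i j = 0) ->
    diag_mx (\row_i (if i \in E then t^-1 else 1)) *m g
      *m diag_mx (\row_j (if j \in S then t else 1)) = base E g + t *: dir E g.
  move=> t0 gE; apply/matrixP => i j; rewrite mul_mx_diag mul_diag_mx !mxE.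
  case: (boolP (i \in E)) => /= iE; case: (boolP (j \in S)) => /= jS.
  - by rewrite mulr0 addr0 mulrAC mulVf ?mul1r.
  - by rewrite gE // !mulr0 mul0r addr0.
  - by rewrite mul1r add0r mulrC.
  - by rewrite mulr0 addr0 mul1r mulr1.
pose e := (\sum_(i in A) lambda i + \sum_(i in B) mu i - \sum_(j in S) nu j)%N.
have e0 : (0 < e)%N by rewrite subn_gt0.
have charE (E : {set 'I_r}) (kappa : 'I_r -> nat) (t : K) :
    \prod_i ((\row_i (if i \in E then t else 1)) : 'rV[K]_r) 0 i ^+ kappa i
    = t ^+ (\sum_(i in E) kappa i).
  rewrite -prodrXr [RHS]big_mkcond; apply: eq_bigr => i _; rewrite mxE.
  by case: ifP => // _; rewrite expr1n.
have pE t : t != 0 -> t ^+ e * p.[t] = F (g1, g2).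
  move=> t0; rewrite -hp.
  have -> : (base A g1, base B g2) + t *: (dir A g1, dir B g2) =
    (base A g1 + t *: dir A g1, base B g2 + t *: dir B g2) by [].
  have neq0 (E : {set 'I_r}) (c : K) : c != 0 ->
      forall i, ((\row_i (if i \in E then c else 1)) : 'rV[K]_r) 0 i != 0.
    by move=> c0 i; rewrite mxE; case: ifP; rewrite ?oner_eq0.
  rewrite -!scale // hF.
  - rewrite !tri_char_diag !charE !exprVn -invfM -exprD.
    rewrite mulrA -[RHS]mul1r; congr (_ * _).
    rewrite mulrCA -exprD /e subnK; last exact: ltnW.
    by rewrite mulVf // expf_neq0.
  - by apply: low_tri_diag; apply: neq0; rewrite invr_eq0.
  - by apply: low_tri_diag; apply: neq0; rewrite invr_eq0.
  - by rewrite tr_diag_mx; apply: low_tri_diag; apply: neq0.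
(* The identity [pE] is known for [t != 0] only; the factor ['X] covers [t = 0]. Once it is
   cancelled, evaluation at 0 gives the claim because [e > 0]. *)
have p0 : 'X * ('X ^+ e * p - (F (g1, g2))%:P) = 0.
  apply: poly_eq0_nat => k; rewrite !hornerE.
  have [->|k0] := eqVneq (k%:R : K) 0; first by rewrite mul0r.
  by rewrite pE // subrr mulr0.
move/eqP: p0; rewrite mulf_eq0 polyX_eq0 /= => /eqP /(congr1 (horner^~ 0)).
by rewrite !hornerE /= expr0n eqn0Ngt e0 mul0r sub0r => /eqP; rewrite oppr_eq0 => /eqP.
Qed.

(** Upper triangular column operations only add a column to later ones, so the pivot is the first
    nonzero entry. The last clause, that rows vanishing at the pivot are fixed, allows a second
    clearing that does not disturb the first. *)
Lemma clear_row (p : 'rV[K]_r) : exists b (S : {set 'I_r}),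
  [/\ low_tri b^T, (#|S| <= 1)%N, forall j, j \in S -> p 0 j != 0,
      forall j, j \notin S -> (p *m b) 0 j = 0 &
      forall q : 'rV[K]_r, (forall j, j \in S -> q 0 j = 0) -> q *m b = q].
Proof.
case: (pickP (fun j => p 0 j != 0)) => [c0 pc0|p0]; last first.
  exists 1%:M, set0; rewrite trmx1 cards0; split=> //; first exact: low_tri1.
  - by move=> j; rewrite inE.
  - by move=> j _; rewrite mulmx1; apply/eqP/negbFE/p0.
  - by move=> q _; rewrite mulmx1.
case: (@arg_minnP _ c0 (fun j => p 0 j != 0) val pc0) => c pc cmin.
pose q0 : 'rV[K]_r := (p 0 c)^-1 *: p - delta_mx 0 c.
have q00 (j : 'I_r) : (j <= c)%N -> q0 0 j = 0.
  rewrite leq_eqVlt => /predU1P[/val_inj ->|jc].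
    by rewrite !mxE !eqxx mulVf // subrr.
  rewrite !mxE; have -> : p 0 j = 0.
    by apply: contraTeq jc => /cmin; rewrite -leqNgt.
  by rewrite mulr0 eqxx -val_eqE /= ltn_eqF // subrr.
exists (1%:M - (delta_mx c 0 : 'cV[K]_r) *m q0), [set c].
have bE i j : (1%:M - (delta_mx c 0 : 'cV[K]_r) *m q0) i j
    = (i == j)%:R - (i == c)%:R * q0 0 j.
  rewrite [LHS]mxE [X in X + _]mxE [X in _ + X]mxE mxE big_ord1 [X in X * _]mxE.
  by rewrite eqxx andbT.
have mulE (q : 'rV[K]_r) :
    q *m (1%:M - (delta_mx c 0 : 'cV[K]_r) *m q0) = q - q 0 c *: q0.
  rewrite mulmxBr mulmx1 mulmxA; congr (_ - _).
  have -> : q *m delta_mx c 0 = (q 0 c)%:M.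
    by rewrite -colE; apply/matrixP => i j; rewrite !ord1 !mxE mulr1n.
  by rewrite mul_scalar_mx.
split.
- split=> [|i]; last first.
    rewrite mxE bE eqxx; case: (i =P c) => [->|_] /=; last first.
      by rewrite mul0r subr0 oner_eq0.
    by rewrite q00 // mulr0 subr0 oner_eq0.
  apply/is_trig_mxP => i j ij; rewrite mxE bE -val_eqE /= gtn_eqF // sub0r.
  case: (j =P c) => [jc|_]; rewrite /= ?mul0r ?oppr0 //.
  by rewrite q00 -?jc ?mulr0 ?oppr0 // ltnW.
- by rewrite cards1.
- by move=> j /set1P ->.
- move=> j; rewrite inE => jc; rewrite mulE /q0 scalerBr scalerA divff //.
  by rewrite scale1r opprB addrC subrK !mxE (negPf jc) andbF mulr0.
- by move=> q hq; rewrite mulE hq ?set11 // scale0r subr0.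
Qed.

(** Clear [q], then what remains of [p] off the pivot of [q]. The pivot in [S1] is a nonzero entry
    of [q] before any operation; this locates it, whereas [S2] may be any column. *)
Lemma clear_two_rows (p q : 'rV[K]_r) : exists b (S1 S2 : {set 'I_r}),
  [/\ low_tri b^T, (#|S1| <= 1)%N /\ (#|S2| <= 1)%N,
      forall j, j \in S1 -> q 0 j != 0,
      forall j, j \notin S1 -> (q *m b) 0 j = 0 &
      forall j, j \notin S1 :|: S2 -> (p *m b) 0 j = 0].
Proof.
have [b [S [[tb db] S1 Sq qb eb]]] := clear_row q.
pose p1 : 'rV[K]_r := \row_j if j \in S then 0 else (p *m b) 0 j.
have [b' [S' [[tb' db'] S1' Sp' pb' eb']]] := clear_row p1.
have p1S j : j \in S' -> j \notin S.
  by move=> /Sp'; rewrite mxE; case: (j \in S); rewrite ?eqxx.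
have eS (x : 'rV[K]_r) : (forall j, j \notin S -> x 0 j = 0) -> x *m b' = x.
  by move=> hx; apply: eb' => j /p1S /hx.
exists (b *m b'), S, S'; split=> //.
- by rewrite trmx_mul; apply: low_tri_mul; split.
- by move=> j jS; rewrite mulmxA eS // qb.
- move=> j; rewrite inE negb_or => /andP[jS jS'].
  rewrite mulmxA; have -> : p *m b = p1 + (p *m b - p1) by rewrite addrC subrK.
  rewrite mulmxDl mxE pb' // add0r eS.
    by rewrite !mxE (negPf jS) subrr.
  by move=> k kS; rewrite !mxE (negPf kS) subrr.
Qed.
End Vanishing.

(** * The corner minor and its zeros *)

Section Corner.
Variables (K : numFieldType) (r u v : nat).
Hypotheses (hu : (u <= r)%N) (hv : (v <= r)%N) (huv : (u + v <= r)%N).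
Implicit Types (lambda mu nu : 'I_r -> nat) (b g : 'M[K]_r).

Definition corner (x : 'M[K]_r * 'M[K]_r) : 'M[K]_(u + v) :=
  col_mx (mxsub (widen_ord hu) (widen_ord huv) x.1)
         (mxsub (widen_ord hv) (widen_ord huv) x.2).

Definition pad n (w : nat) (A : 'M[K]_(w, n)) : 'M[K]_(r, n) :=
  \matrix_(i, j) (if insub (i : nat) is Some i' then A i' j else 0).

Lemma padE n w (hw : (w <= r)%N) (A : 'M[K]_(w, n)) i j :
  pad A (widen_ord hw i) j = A i j.
Proof. by rewrite mxE /= (valK i). Qed.

Lemma pad_out n w (A : 'M[K]_(w, n)) (i : 'I_r) j : (w <= i)%N -> pad A i j = 0.
Proof. by move=> wi; rewrite mxE insubN // -leqNgt. Qed.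

Lemma pad_linear n w a (A B : 'M[K]_(w, n)) :
  pad (a *: A + B) = a *: pad A + pad B.
Proof.
by apply/matrixP => i j; rewrite !mxE; case: insub => [i'|]; rewrite ?mxE ?mulr0 ?addr0.
Qed.

Lemma sum_narrow w (hw : (w <= r)%N) (f : 'I_r -> K) :
  (forall i : 'I_r, (w <= i)%N -> f i = 0) ->
  \sum_i f i = \sum_(i < w) f (widen_ord hw i).
Proof.
move=> f0; rewrite -big_ord_narrow [RHS]big_mkcond; apply: eq_bigr => i _.
by case: ltnP => // /f0.
Qed.

Lemma mxsub_low_tri w (hw : (w <= r)%N) n (f : 'I_n -> 'I_r) b g :
  low_tri b -> mxsub (widen_ord hw) f (b *m g)
  = mxsub (widen_ord hw) (widen_ord hw) b *m mxsub (widen_ord hw) f g.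
Proof.
move=> [/is_trig_mxP tb _]; apply/matrixP => i j; rewrite !mxE (sum_narrow hw).
  by apply: eq_bigr => k _; rewrite !mxE.
by move=> k wk; rewrite tb ?mul0r //= (leq_trans _ wk).
Qed.

Lemma mxsub_upp_tri w (hw : (w <= r)%N) n (f : 'I_n -> 'I_r) b g :
  low_tri b^T -> mxsub f (widen_ord hw) (g *m b)
  = mxsub f (widen_ord hw) g *m mxsub (widen_ord hw) (widen_ord hw) b.
Proof.
move=> tb; apply: trmx_inj; rewrite trmx_mul !trmx_mxsub trmx_mul.
exact: mxsub_low_tri.
Qed.

Definition ones (w : nat) : 'I_r -> nat := fun i => (i < w)%N.

Lemma det_mxsub_low_tri w (hw : (w <= r)%N) b : low_tri b ->
  \det (mxsub (widen_ord hw) (widen_ord hw) b) = tri_char (ones w) b.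
Proof.
move=> [/is_trig_mxP tb _]; rewrite det_trig; last first.
  by apply/is_trig_mxP => i j ij; rewrite mxE tb.
rewrite /tri_char (eq_bigr (fun i : 'I_r => if (i < w)%N then b i i else 1)).
  rewrite -big_mkcond big_ord_narrow.
  by apply: eq_bigr => i _; rewrite mxE.
by move=> i _; rewrite /ones; case: ifP.
Qed.

Lemma tri_char_tr lambda b : tri_char lambda b^T = tri_char lambda b.
Proof. by apply: eq_bigr => i _; rewrite mxE. Qed.

Lemma det_mxsub_upp_tri w (hw : (w <= r)%N) b : low_tri b^T ->
  \det (mxsub (widen_ord hw) (widen_ord hw) b) = tri_char (ones w) b.
Proof.
by move=> tb; rewrite -det_tr trmx_mxsub det_mxsub_low_tri // tri_char_tr.
Qed.

Lemma corner_semi_inv2 : semi_inv2 (ones u) (ones v) (ones (u + v))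
  (fun x => \det (corner x)).
Proof.
split=> [|b1 b2 b g1 g2 hb1 hb2 hb].
  apply: polyfun_det => i j; apply: polyfun_linear => a x y.
  by rewrite !mxE; case: split => k; rewrite !mxE.
rewrite /corner /= !(mxsub_upp_tri _ _ _ hb) -mul_col_mx.
rewrite (mxsub_low_tri _ _ _ hb1) (mxsub_low_tri _ _ _ hb2).
set c1 := mxsub _ _ b1; set c2 := mxsub _ _ b2.
set A1 := mxsub _ _ g1; set A2 := mxsub _ _ g2.
have -> : col_mx (c1 *m A1) (c2 *m A2) = block_mx c1 0 0 c2 *m col_mx A1 A2.
  by rewrite mul_block_col !mul0mx addr0 add0r.
rewrite !det_mulmx det_ublock (det_mxsub_upp_tri _ hb).
rewrite (det_mxsub_low_tri _ hb1) (det_mxsub_low_tri _ hb2).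
by ring.
Qed.

Definition corner_section (Z : 'M[K]_(u + v)) : 'M[K]_r * 'M[K]_r :=
  ((pad (pad (usubmx Z))^T)^T, (pad (pad (dsubmx Z))^T)^T).

Lemma corner_sectionK Z : corner (corner_section Z) = Z.
Proof.
rewrite -[RHS]vsubmxK /corner /=.
by congr col_mx; apply/matrixP => i j;
  rewrite mxE mxE padE mxE padE.
Qed.

Lemma corner_linear a x y : corner (a *: x + y) = a *: corner x + corner y.
Proof.
rewrite /corner scale_col_mx add_col_mx.
by congr col_mx; apply/matrixP => i j; rewrite !mxE.
Qed.

Lemma corner_section_linear a x y :
  corner_section (a *: x + y) = a *: corner_section x + corner_section y.
Proof.
by congr pair; rewrite linearP pad_linear !linearP /= pad_linear linearP.
Qed.

(** The identity matrix with one row replaced by [p] stays lower triangular if that row is at the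
    last nonzero entry of [p]. As [p 0 a != 0], the row index [a] is below [u] when [p] is supported
    in the first [u] coordinates, where the weight is bounded below. *)
Lemma row_as_low_tri (p : 'rV[K]_r) : p != 0 ->
  exists b a, [/\ low_tri b, p 0 a != 0 & row a b = p].
Proof.
case/rV0Pn => a0 pa0.
case: (@arg_maxnP _ a0 (fun j => p 0 j != 0) val pa0) => a pa amax.
exists (\matrix_(i, j) if i == a then p 0 j else (i == j)%:R), a; split=> //.
  split=> [|i]; last by rewrite mxE; case: (i =P a) => [->|] //; rewrite eqxx oner_eq0.
  apply/is_trig_mxP => i j ij; rewrite mxE; case: (i =P a) => [ia|_]; last first.
    by rewrite -val_eqE /= ltn_eqF.
  by apply: contraTeq ij => /amax; rewrite ia -leqNgt.
by apply/rowP => j; rewrite !mxE eqxx.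
Qed.

(* If the minor vanishes, combinations p of the first u rows of g1 and q of the first v
   rows of g2 have p + q supported in the last columns.  Triangular operations make
   p a row of g1 and q a row of g2 and reduce their supports to two columns, one of
   them among the last ones. *)
Lemma semi_inv2_vanish lambda mu nu F (m N L M : nat) x :
  semi_inv2 lambda mu nu F ->
  (forall i : 'I_r, (i < u)%N -> (L <= lambda i)%N) ->
  (forall i : 'I_r, (i < v)%N -> (M <= mu i)%N) ->
  (forall i, nu i <= m)%N ->
  (forall i : 'I_r, (u + v <= i)%N -> (nu i <= N)%N) ->
  (L <= m)%N -> (M <= m)%N -> (N + m < L + M)%N ->
  \det (corner x) = 0 -> F x = 0.
Proof.
move=> hF hL hM hm hN Lm Mm NmLM /eqP/det0P[ab ab0].
rewrite -[ab]hsubmxK in ab0 *.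
set al := lsubmx ab in ab0 *; set be := rsubmx ab in ab0 *.
case: x => g1 g2; rewrite /corner mul_row_col /=.
pose p := (pad al^T)^T *m g1; pose q := (pad be^T)^T *m g2.
have padm w (hw : (w <= r)%N) (c : 'rV[K]_w) g j :
    ((pad c^T)^T *m g) 0 (widen_ord huv j)
    = (c *m mxsub (widen_ord hw) (widen_ord huv) g) 0 j.
  rewrite !mxE (sum_narrow hw) => [|k wk].
    by apply: eq_bigr => k _; rewrite mxE padE !mxE.
  by rewrite mxE pad_out ?mul0r.
have pad0 w (hw : (w <= r)%N) (c : 'rV[K]_w) : c != 0 -> (pad c^T)^T != 0.
  case/rV0Pn => i ci; apply/rV0Pn; exists (widen_ord hw i).
  by rewrite mxE padE mxE.
have padlt w (c : 'rV[K]_w) a : (pad c^T)^T 0 a != 0 -> (a < w)%N.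
  by apply: contraNltn => wa; rewrite mxE pad_out.
move=> pq0.
have {pq0} pq (j : 'I_r) : (j < u + v)%N -> (p + q) 0 j = 0.
  move=> js; have -> : j = widen_ord huv (Ordinal js) by apply: val_inj.
  rewrite mxE (padm _ hu) (padm _ hv).
  by move/matrixP/(_ 0 (Ordinal js)): pq0; rewrite mxE [RHS]mxE.
have cardle (S : {set 'I_r}) c : (#|S| <= 1)%N ->
    (forall j, j \in S -> nu j <= c)%N -> (\sum_(j in S) nu j <= c)%N.
  move=> S1 hS; apply: (@leq_trans (\sum_(j in S) c)); first exact: leq_sum.
  by rewrite sum_nat_const; case: #|S| S1 => [|[|]] //; rewrite mul1n.
(* The action of [b1], [b2], [b] changes [F] by nonzero characters only, so [semi_inv2_support] may
   be applied to the transformed pair, whose rows in [A] and in [B] are [p *m b] and [q *m b]. *)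
have reduce (A B S : {set 'I_r}) b1 b2 b :
    low_tri b1 -> low_tri b2 -> low_tri b^T ->
    (forall a, a \in A -> row a b1 = (pad al^T)^T) ->
    (forall a, a \in B -> row a b2 = (pad be^T)^T) ->
    (A != set0 -> forall j, j \notin S -> (p *m b) 0 j = 0) ->
    (B != set0 -> forall j, j \notin S -> (q *m b) 0 j = 0) ->
    (\sum_(j in S) nu j < \sum_(i in A) lambda i + \sum_(i in B) mu i)%N ->
    F (g1, g2) = 0.
  move=> hb1 hb2 hb rA rB pS qS lt.
  have [_ /(_ b1 b2 b g1 g2 hb1 hb2 hb)] := hF.
  rewrite (semi_inv2_support (A := A) (B := B) (S := S)
    (g1 := b1 *m g1 *m b) (g2 := b2 *m g2 *m b) hF) //; first last.
  - move=> i j iB jS; rewrite -[RHS](qS _ j jS); last by apply/set0Pn; exists i.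
    by rewrite /q -(rB i) // -!row_mul [RHS]mxE.
  - move=> i j iA jS; rewrite -[RHS](pS _ j jS); last by apply/set0Pn; exists i.
    by rewrite /p -(rA i) // -!row_mul [RHS]mxE.
  have b0 i : b i i != 0 by have [_ /(_ i)] := hb; rewrite mxE.
  move/esym/eqP; rewrite !mulf_eq0 (negPf (tri_char_neq0 nu b0)).
  rewrite (negPf (tri_char_neq0 lambda hb1.2)).
  by rewrite (negPf (tri_char_neq0 mu hb2.2)) => /eqP.
have padz w : pad (0 : 'cV[K]_w) = 0.
  by apply/matrixP => i k; rewrite !mxE; case: insub => // i'; rewrite mxE.
(* If one combination is zero, the other is itself supported in the last columns and a single pivot
   remains; [L <= m] or [M <= m] then reduces the numerical condition to [N < M] or [N < L]. *)
have [al0|al0] := eqVneq al 0.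
  have be0 : be != 0.
    by apply: contraNneq ab0 => ->; rewrite al0 row_mx0.
  have [b2 [a [hb2 ba rb2]]] := row_as_low_tri (pad0 _ hv _ be0).
  have [b [S [hb S1 Sq qS _]]] := clear_row q.
  apply: (reduce set0 [set a] S 1%:M b2 b) => //.
  - exact: low_tri1.
  - by move=> i; rewrite inE.
  - by move=> i /set1P ->.
  - by rewrite eqxx.
  rewrite big_set0 add0n big_set1.
  have := hM a (padlt _ _ _ ba).
  have : (\sum_(j in S) nu j <= N)%N; last lia.
  apply: cardle => // j /Sq qj; apply: hN; apply: contraNleq qj => js.
  by have := pq j js; rewrite /p al0 trmx0 padz trmx0 mul0mx add0r => ->.
have [b1 [a1 [hb1 ba1 rb1]]] := row_as_low_tri (pad0 _ hu _ al0).
have [be0|be0] := eqVneq be 0.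
  have [b [S [hb S1 Sp pS _]]] := clear_row p.
  apply: (reduce [set a1] set0 S b1 1%:M b) => //.
  - exact: low_tri1.
  - by move=> i /set1P ->.
  - by move=> i; rewrite inE.
  - by rewrite eqxx.
  rewrite big_set0 addn0 big_set1.
  have := hL a1 (padlt _ _ _ ba1).
  have : (\sum_(j in S) nu j <= N)%N; last lia.
  apply: cardle => // j /Sp pj; apply: hN; apply: contraNleq pj => js.
  by have := pq j js; rewrite /q be0 trmx0 padz trmx0 mul0mx addr0 => ->.
have [b2 [a2 [hb2 ba2 rb2]]] := row_as_low_tri (pad0 _ hv _ be0).
(* The rows cleared are [p] and [p + q], since the pivot of [p + q] is among the last columns and
   costs at most [N]; the other costs at most [m]. Both [p] and [q] end up supported in the two
   pivots. *)
have [b [S1 [S2 [hb [S1c S2c] S1pq pqS pS]]]] := clear_two_rows p (p + q).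
have S1N : (\sum_(j in S1) nu j <= N)%N.
  apply: cardle => // j /S1pq pqj; apply: hN.
  by apply: contraNleq pqj => js; rewrite pq.
have S2m : (\sum_(j in S2) nu j <= m)%N by apply: cardle.
have qS j : j \notin S1 :|: S2 -> (q *m b) 0 j = 0.
  move=> jS; have -> : q = (p + q) - p by rewrite addrC addKr.
  have jS1 : j \notin S1 by apply: contra jS; rewrite inE => ->.
  by rewrite mulmxBl mxE pqS // mxE pS // oppr0 addr0.
apply: (reduce [set a1] [set a2] (S1 :|: S2) b1 b2 b) => //.
- by move=> i /set1P ->.
- by move=> i /set1P ->.
rewrite !big_set1; have := hL a1 (padlt _ _ _ ba1).
have := hM a2 (padlt _ _ _ ba2).
have : (\sum_(j in S1 :|: S2) nu j
        <= \sum_(j in S1) nu j + \sum_(j in S2) nu j)%N; last lia.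
rewrite !(big_mkcond (fun j => j \in _)) -big_split /=.
by apply: leq_sum => j _; rewrite inE; do 2!case: ifP => //=; lia.
Qed.
End Corner.

(** * Multiplication and division by the corner minor *)

Section Factorization.
Variables (K : numFieldType) (r u v : nat).
Hypotheses (hu : (u <= r)%N) (hv : (v <= r)%N) (huv : (u + v <= r)%N).

Lemma tri_charD (l1 l2 l : 'I_r -> nat) (b : 'M[K]_r) :
  (forall i, l i = l1 i + l2 i)%N ->
  tri_char l b = tri_char l1 b * tri_char l2 b.
Proof. by move=> hl; rewrite -big_split; apply: eq_bigr => i _; rewrite hl exprD. Qed.

Variables (lambda mu nu lambda' mu' nu' : 'I_r -> nat).
Hypothesis hl : forall i, lambda i = (ones u i + lambda' i)%N.
Hypothesis hm : forall i, mu i = (ones v i + mu' i)%N.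
Hypothesis hn : forall i, nu i = (ones (u + v) i + nu' i)%N.

Local Notation D := (fun x : 'M[K]_r * 'M[K]_r => \det (corner hu hv huv x)).

Lemma det_corner_cancel (f : 'M[K]_r * 'M[K]_r -> K) :
  polyfun f -> (forall x, D x * f x = 0) -> forall x, f x = 0.
Proof.
move=> pf hf; have [pD _] := corner_semi_inv2 K hu hv huv.
have D1 : \det (corner hu hv huv (@corner_section K r u v 1%:M)) != 0.
  by rewrite corner_sectionK det1 oner_eq0.
by apply: (polyfun_idomain pf pD _ D1) => x; rewrite mulrC hf.
Qed.

Lemma semi_inv2_mul_corner F : semi_inv2 lambda' mu' nu' F ->
  semi_inv2 lambda mu nu (fun x => D x * F x).
Proof.
have [pD hD] := corner_semi_inv2 K hu hv huv.
case=> pF hF; split=> [|b1 b2 b g1 g2 h1 h2 h]; first exact: polyfunM.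
rewrite hD // hF // (tri_charD _ hl) (tri_charD _ hm) (tri_charD _ hn).
by ring.
Qed.

Lemma semi_inv2_div_corner F (m N L M : nat) :
  semi_inv2 lambda mu nu F ->
  (forall i : 'I_r, (i < u)%N -> (L <= lambda i)%N) ->
  (forall i : 'I_r, (i < v)%N -> (M <= mu i)%N) ->
  (forall i, nu i <= m)%N ->
  (forall i : 'I_r, (u + v <= i)%N -> (nu i <= N)%N) ->
  (L <= m)%N -> (M <= m)%N -> (N + m < L + M)%N ->
  exists2 Q, semi_inv2 lambda' mu' nu' Q & forall x, F x = D x * Q x.
Proof.
move=> sF hL hM hnm hnN Lm Mm NmLM.
have [pD hD] := corner_semi_inv2 K hu hv huv.
have [pF hF] := sF.
have [Q [pQ FE]] := polyfun_dvd_det (corner_linear hu hv huv)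
  (@corner_section_linear K r u v) (corner_sectionK hu hv huv) pF
  (fun x => semi_inv2_vanish sF hL hM hnm hnN Lm Mm NmLM).
exists Q => //; split=> // b1 b2 b g1 g2 h1 h2 h.
have b0 i : b i i != 0 by have [_ /(_ i)] := h; rewrite mxE.
apply/eqP; rewrite -subr_eq0; apply/eqP.
pose act (x : 'M[K]_r * 'M[K]_r) := (b1 *m x.1 *m b, b2 *m x.2 *m b).
(* [f] is the failure of [Q] to be semi-invariant; the semi-invariance of [F] and of the minor makes
   the minor times [f] vanish. *)
pose f x := Q (act x) - tri_char lambda' b1 * tri_char mu' b2 * tri_char nu' b * Q x.
apply: (@det_corner_cancel f _ _ (g1, g2)) => [|[x1 x2]].
  apply: polyfunB; last by apply: polyfunM => //; exact: polyfun_cst.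
  have lin (c1 c2 : 'M[K]_r) (pr : 'M[K]_r * 'M[K]_r -> 'M[K]_r) i j :
      (forall a x y, pr (a *: x + y) = a *: pr x + pr y) ->
      polyfun (fun x => (c1 *m pr x *m c2) i j).
    move=> hpr; apply: polyfun_linear => a x y.
    by rewrite hpr mulmxDr mulmxDl -scalemxAr -scalemxAl !mxE.
  by apply: polyfun_pair pQ => i j; apply: lin.
have := hF _ _ _ x1 x2 h1 h2 h; rewrite !FE hD //.
rewrite (tri_charD _ hl) (tri_charD _ hm) (tri_charD _ hn) /f /act /=.
set c1 := tri_char (ones u) b1; set c2 := tri_char (ones v) b2.
set c3 := tri_char (ones (u + v)) b => E.
have c0 : c1 * c2 * c3 != 0.
  by rewrite !mulf_neq0 ?tri_char_neq0 //; [case: h1|case: h2].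
apply: (mulfI c0); rewrite mulr0 mulrBr mulrBr mulrA mulrA E; ring.
Qed.

End Factorization.

(** * The Fischer product *)

Section Fischer.
Variables (C : numClosedFieldType) (n : nat).
Implicit Types (p q : {mpoly C[n]}) (A B : 'M[C]_n).

Lemma mnm_subxx (m : 'X_{1..n}) : (m - m)%MM = 0%MM.
Proof. by apply/mnmP => k; rewrite mnmBE mnm0E subnn. Qed.

Lemma mnm_neq0_split (m : 'X_{1..n}) : m != 0%MM ->
  exists i m', m = (m' + U_(i))%MM /\ mdeg m = (mdeg m').+1.
Proof.
rewrite -mdeg_eq0 => m0.
case: (pickP (fun i => m i != 0%N)) => [i|h]; last first.
  by case/eqP: m0; rewrite mdegE; apply: big1 => i _; apply/eqP/negbFE/h.
rewrite -lep1mP => im; exists i, (m - U_(i))%MM; rewrite submK //; split=> //.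
by have := mdegD (m - U_(i))%MM U_(i)%MM; rewrite submK // mdeg1 addn1.
Qed.

Lemma mpoly_var_ind (P : {mpoly C[n]} -> Prop) :
  P 0 -> (forall c p q, P p -> P q -> P (c *: p + q)) -> P 1 ->
  (forall i p, P p -> P ('X_i * p)) -> forall p, P p.
Proof.
move=> P0 PD P1 PX; apply: mpolyind => // c m p _ _ Pp; apply: PD => //.
have [d] := ubnP (mdeg m); elim: d m => // d IH m; rewrite ltnS => md.
have [->|/mnm_neq0_split[i [m' [mE em]]]] := eqVneq m 0%MM; first by rewrite mpolyX0.
by rewrite mE addmC mpolyXD; apply: PX; apply: IH; rewrite -em.
Qed.

Lemma mpoly_alg_ind (P : {mpoly C[n]} -> Prop) :
  (forall c, P c%:MP) -> (forall i, P 'X_i) ->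
  (forall p q, P p -> P q -> P (p + q)) ->
  (forall p q, P p -> P q -> P (p * q)) -> forall p, P p.
Proof.
move=> Pc PX PD PM; apply: mpoly_var_ind.
- by rewrite -mpolyC0.
- by move=> c p q Pp Pq; rewrite -mul_mpolyC; apply: PD => //; apply: PM.
- by rewrite -mpolyC1.
- by move=> i p Pp; apply: PM.
Qed.

Lemma mcoeff0_meval p : p.@[fun=> 0] = p@_0.
Proof.
elim/mpoly_alg_ind: p => [c|i|p q IHp IHq|p q IHp IHq].
- by rewrite mevalC mcoeffC eqxx mulr1.
- by rewrite mevalXU mcoeffX mnm1_eq0.
- by rewrite mevalD mcoeffD IHp IHq.
- by rewrite mevalM rmorphM /= IHp IHq.
Qed.

(** If [p] vanishes as a function then so do its partial derivatives, by restriction to coordinate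
    lines. A coefficient of positive degree is, up to a nonzero integer, one of a derivative, and
    the constant one is the value at 0. *)
Lemma meval_inj p : (forall v, p.@[v] = 0) -> p = 0.
Proof.
have meval_deriv i q : (forall v, q.@[v] = 0) -> forall v, (q^`M(i)).@[v] = 0.
  move=> q0 v.
  pose line : 'I_n -> {poly C} := fun j => (v j)%:P + (j == i)%:R *: 'X.
  pose phi : {mpoly C[n]} -> {poly C} := mmap polyC line.
  have phiC c : phi c%:MP = c%:P by exact: mmapC.
  have phiX j : phi 'X_j = line j by rewrite /phi mmapX mmap1U.
  have phiD s1 s2 : phi (s1 + s2) = phi s1 + phi s2 by exact: mmapD.
  have phiM s1 s2 : phi (s1 * s2) = phi s1 * phi s2 by exact: rmorphM.
  have phiE t s : (phi s).[t] = s.@[fun j => v j + (j == i)%:R * t].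
    elim/mpoly_alg_ind: s => [c|j|s1 s2 IH1 IH2|s1 s2 IH1 IH2].
    - by rewrite phiC hornerC mevalC.
    - by rewrite phiX /line !hornerE mevalXU.
    - by rewrite phiD hornerD mevalD -IH1 -IH2.
    - by rewrite phiM hornerM mevalM -IH1 -IH2.
  have dphi s : (phi s)^`() = phi s^`M(i).
    elim/mpoly_alg_ind: s => [c|j|s1 s2 IH1 IH2|s1 s2 IH1 IH2].
    - by rewrite phiC derivC mderivC /phi mmap0.
    - rewrite phiX /line derivD derivC derivZ derivX add0r mderivX.
      rewrite mnm1E -mul_mpolyC phiM phiC; have [->|ji] := eqVneq j i.
        by rewrite scale1r mul1r mnm_subxx mpolyX0 -mpolyC1 phiC.
      by rewrite scale0r mul0r.
    - by rewrite mderivD !phiD derivD -IH1 -IH2.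
    - by rewrite mderivM phiM phiD !phiM derivM IH1 IH2.
  have phi0 : phi q = 0 by apply: poly_eq0_nat => k; rewrite phiE.
  have := phiE 0 q^`M(i); rewrite -dphi phi0 deriv0 horner0 => /esym.
  by rewrite (@meval_eq _ _ _ v) // => j; rewrite mulr0 addr0.
move=> p0; apply/mpolyP => m; rewrite mcoeff0.
have [d] := ubnP (mdeg m); elim: d m p p0 => // d IH m p p0 md.
have [->|/mnm_neq0_split[i [m' [mE em]]]] := eqVneq m 0%MM.
  by rewrite -mcoeff0_meval.
have /eqP : (p^`M(i))@_m' = 0 by apply: IH (meval_deriv i p p0) _; rewrite -em.
by rewrite mcoeff_deriv mulrn_eq0 -mE => /eqP.
Qed.

Definition mfact (m : 'X_{1..n}) : nat := \prod_i (m i)`!.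

(** The factorials make multiplication by a variable adjoint to the derivative in that variable
    ([fischerX]). *)
Definition fischer p q : C := \sum_(m <- msupp p) (mfact m)%:R * p@_m * (q@_m)^*.

Lemma fischerE s p q : uniq s -> {subset msupp p <= s} ->
  fischer p q = \sum_(m <- s) (mfact m)%:R * p@_m * (q@_m)^*.
Proof.
move=> us ps; rewrite /fischer [RHS](bigID (mem (msupp p))) /=.
rewrite [X in _ + X]big1 => [|m /memN_msupp_eq0 ->]; last by rewrite mulr0 mul0r.
rewrite addr0 -[RHS]big_filter; apply: perm_big; apply: uniq_perm.
- exact: msupp_uniq.
- exact: filter_uniq.
by move=> m; rewrite mem_filter /= andb_idr // => /ps.
Qed.

Lemma fischer_linear q a p1 p2 :
  fischer (a *: p1 + p2) q = a * fischer p1 q + fischer p2 q.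
Proof.
pose s := undup (msupp (a *: p1 + p2) ++ msupp p1 ++ msupp p2).
have us : uniq s by exact: undup_uniq.
have hs p : {subset msupp p <= msupp (a *: p1 + p2) ++ msupp p1 ++ msupp p2} ->
    {subset msupp p <= s} by move=> h m /h; rewrite mem_undup.
rewrite !(fischerE _ us); last 3 first.
- by apply: hs => m mp; rewrite !mem_cat mp !orbT.
- by apply: hs => m mp; rewrite !mem_cat mp !orbT.
- by apply: hs => m mp; rewrite !mem_cat mp.
rewrite mulr_sumr -big_split; apply: eq_bigr => m _.
by rewrite mcoeffD mcoeffZ /=; ring.
Qed.

Lemma fischer_herm p q : fischer q p = (fischer p q)^*.
Proof.
pose s := undup (msupp p ++ msupp q).
have us : uniq s by exact: undup_uniq.
rewrite !(fischerE _ us); last 2 first.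
- by move=> m mp; rewrite mem_undup mem_cat mp.
- by move=> m mp; rewrite mem_undup mem_cat mp orbT.
rewrite rmorph_sum; apply: eq_bigr => m _.
by rewrite !rmorphM /= conjCK rmorph_nat -!mulrA [_^* * _]mulrC.
Qed.

Lemma fischer_linearr p a q1 q2 :
  fischer p (a *: q1 + q2) = a^* * fischer p q1 + fischer p q2.
Proof.
by rewrite fischer_herm fischer_linear rmorphD rmorphM /= -!fischer_herm.
Qed.

Lemma fischer0l q : fischer 0 q = 0.
Proof. by rewrite /fischer msupp0 big_nil. Qed.

Lemma fischer0r p : fischer p 0 = 0.
Proof. by rewrite fischer_herm fischer0l conjC0. Qed.

Lemma fischer_suml (I : Type) (s : seq I) (a : I -> C) (e : I -> {mpoly C[n]}) q :
  fischer (\sum_(i <- s) a i *: e i) q = \sum_(i <- s) a i * fischer (e i) q.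
Proof.
elim: s => [|i s IH]; first by rewrite !big_nil fischer0l.
by rewrite !big_cons fischer_linear IH.
Qed.

Lemma fischer_sumr (I : Type) (s : seq I) (a : I -> C) (e : I -> {mpoly C[n]}) p :
  fischer p (\sum_(i <- s) a i *: e i) = \sum_(i <- s) (a i)^* * fischer p (e i).
Proof.
elim: s => [|i s IH]; first by rewrite !big_nil fischer0r.
by rewrite !big_cons fischer_linearr IH.
Qed.

Lemma fischer_eq0 p : fischer p p = 0 -> p = 0.
Proof.
have ge0 m : 0 <= (mfact m)%:R * p@_m * (p@_m)^*.
  by rewrite -mulrA mulr_ge0 ?ler0n // mul_conjC_ge0.
move/eqP; rewrite psumr_eq0 // => /allP h; apply/msuppnil0.
case E: (msupp p) => [|m s] //; have := h m; rewrite E mem_head => /(_ isT) /=.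
rewrite -mulrA mulf_eq0 mul_conjC_eq0 pnatr_eq0 -leqn0 leqNgt prodn_gt0 => [|i].
  by rewrite mcoeff_eq0 E mem_head.
exact: fact_gt0.
Qed.

Lemma fischerX i p q : fischer ('X_i * p) q = fischer p q^`M(i).
Proof.
elim/mpolyind: p => [|c m p _ _ IH]; first by rewrite mulr0 !fischer0l.
rewrite mulrDr -scalerAr !fischer_linear IH; congr (_ * _ + _).
rewrite -mpolyXD /fischer !msuppX !big_seq1 !mcoeffX !eqxx !mulr1.
rewrite mcoeff_deriv addmC rmorphMn /= mulrnAr -mulrnAl -mulrnA.
congr (_%:R * _); rewrite /mfact (bigD1 i) //= [in RHS](bigD1 i) //=.
rewrite (eq_bigr (fun j => (m j)`!)) => [|j ji]; last first.
  by rewrite mnmDE mnm1E eq_sym (negPf ji) addn0.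
by rewrite mnmDE mnm1E eqxx addn1 factS [RHS]mulnC mulnA.
Qed.

Definition lsub A p : {mpoly C[n]} :=
  p \mPo [tuple \sum_k A k l *: 'X_k | l < n].

Lemma meval_lsub A p (x : 'rV[C]_n) :
  (lsub A p).@[fun l => x 0 l] = p.@[fun l => (x *m A) 0 l].
Proof.
rewrite /lsub comp_mpoly_meval; apply: meval_eq => l.
rewrite tnth_mktuple raddf_sum mxE; apply: eq_bigr => k _ /=.
by rewrite mevalZ mevalXU mulrC.
Qed.

Lemma lsubXU A i : lsub A 'X_i = \sum_k A k i *: 'X_k.
Proof. by rewrite /lsub comp_mpolyXU -tnth_nth tnth_mktuple. Qed.

Lemma lsubM A p q : lsub A (p * q) = lsub A p * lsub A q.
Proof. exact: rmorphM. Qed.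

Lemma lsubD A p q : lsub A (p + q) = lsub A p + lsub A q.
Proof. exact: comp_mpolyD. Qed.

Lemma lsub_linear A a p q : lsub A (a *: p + q) = a *: lsub A p + lsub A q.
Proof. by rewrite /lsub comp_mpolyD comp_mpolyZ. Qed.

Lemma mderiv_lsub A i p :
  (lsub A p)^`M(i) = \sum_k A i k *: lsub A p^`M(k).
Proof.
elim/mpoly_alg_ind: p => [c|l|p q IHp IHq|p q IHp IHq].
- rewrite /lsub comp_mpolyC mderivC big1 // => k _.
  by rewrite mderivC comp_mpoly0 scaler0.
- rewrite lsubXU raddf_sum /= (bigD1 i) //= [in RHS](bigD1 l) //=.
  rewrite !mderivZ !mderivX !mnm1E !eqxx !scale1r !mnm_subxx !mpolyX0.
  rewrite /lsub comp_mpoly1; congr (_ + _).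
  rewrite !big1 // => k ki; rewrite ?mderivZ mderivX mnm1E.
    by rewrite eq_sym (negPf ki) scale0r comp_mpoly0 scaler0.
  by rewrite (negPf ki) scale0r scaler0.
- rewrite lsubD mderivD IHp IHq -big_split.
  by apply: eq_bigr => k _; rewrite mderivD lsubD scalerDr.
- rewrite lsubM mderivM IHp IHq mulr_suml mulr_sumr -big_split.
  by apply: eq_bigr => k _; rewrite mderivM lsubD !lsubM scalerDr scalerAl scalerAr.
Qed.

Definition adjmx m k (A : 'M[C]_(m, k)) : 'M[C]_(k, m) := (map_mx Num.conj A)^T.

(** By [fischerX] a variable split off from [p] becomes a derivative on the right, and the chain
    rule [mderiv_lsub] produces exactly the conjugated coefficients. This is the source of
    contravariance for right translations. *)
Lemma fischer_lsub A p q : fischer (lsub A p) q = fischer p (lsub (adjmx A) q).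
Proof.
elim/mpoly_var_ind: p q => [|c p1 p2 IH1 IH2||i p IH] q.
- by rewrite /lsub comp_mpoly0 !fischer0l.
- by rewrite lsub_linear !fischer_linear IH1 IH2.
- rewrite /lsub comp_mpoly1 /fischer -mpolyC1 msuppC oner_eq0 !big_seq1.
  by rewrite -!mcoeff0_meval comp_mpoly_meval; congr (_ * _^*);
     apply: meval_eq => l; rewrite tnth_mktuple raddf_sum big1 //= => k _;
     rewrite mevalZ mevalXU mulr0.
- rewrite lsubM lsubXU fischerX mderiv_lsub mulr_suml fischer_sumr.
  transitivity (\sum_k A k i * fischer (lsub A p) q^`M(k)).
    elim: (index_enum _) => [|k s IHs]; first by rewrite !big_nil fischer0l.
    by rewrite !big_cons -scalerAl fischer_linear fischerX IHs.
  by apply: eq_bigr => k _; rewrite IH !mxE conjCK.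
Qed.

End Fischer.

(** * Semi-invariants of one matrix *)

Section TriangularCell.
Variable K : numFieldType.

Lemma low_tri_block n (a : 'M[K]_1) (c : 'cV[K]_n) (b : 'M[K]_n) :
  a 0 0 != 0 -> low_tri b -> low_tri (block_mx a 0 c b : 'M_(1 + n)).
Proof.
move=> a0 [tb b0]; split=> [|i].
  by rewrite is_trig_block_mx // eqxx tb andbT mx11_is_trig.
rewrite -(splitK i); case: (split i) => k /=.
  by rewrite block_mxEul (ord1 k).
by rewrite block_mxEdr.
Qed.

(** Gaussian elimination on the open cell. The recursion uses the Schur complement multiplied by the
    pivot [a g], so that [f] stays polynomial; the factors are rescaled by its inverse. *)
Lemma low_upp_cell r : exists2 f : 'M[K]_r -> K, polyfun f & f 1%:M != 0 /\
  forall g, f g != 0 ->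
    exists b1 b, [/\ low_tri b1, low_tri b^T & g = b1 *m b].
Proof.
elim: r => [|r [f pf [f1 hf]]].
  exists (fun=> 1); first exact: polyfun_cst.
  split=> [|g _]; first exact: oner_neq0.
  exists 1%:M, 1%:M; rewrite trmx1; split; try exact: low_tri1.
  by apply/matrixP => -[].
pose a (g : 'M[K]_(1 + r)) := g 0 0.
pose s (g : 'M[K]_(1 + r)) : 'M_r := a g *: drsubmx g - dlsubmx g *m ursubmx g.
exists (fun g => a g * f (s g)).
  apply: polyfunM; first exact: polyfun_coef.
  apply: polyfun_mx pf => i j.
  apply: (@polyfun_ext _ _ (fun g : 'M[K]_(1 + r) => a g * g (rshift 1 i) (rshift 1 j) -
     g (rshift 1 i) 0 * g 0 (rshift 1 j))).
    by apply: polyfunB; apply: polyfunM; exact: polyfun_coef.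
  move=> g; rewrite !mxE big_ord1 !mxE; congr (_ * _ - g _ _ * g _ _);
    by apply: val_inj.
suff hcell (g : 'M[K]_(1 + r)) : a g * f (s g) != 0 ->
    exists b1 b : 'M[K]_(1 + r), [/\ low_tri b1, low_tri b^T & g = b1 *m b].
  split=> [|g]; last exact: hcell.
  rewrite /a mxE eqxx mul1r; suff -> : s 1%:M = 1%:M by [].
  rewrite /s /a mxE eqxx scale1r; apply/matrixP => i j.
  by rewrite !mxE big_ord1 !mxE /= mul0r subr0.
rewrite mulf_eq0 negb_or => /andP[a0 /hf[b1 [b [h1 h E]]]].
exists (block_mx 1%:M 0 ((a g)^-1 *: dlsubmx g) b1 : 'M_(1 + r)),
  (block_mx (a g)%:M (ursubmx g) 0 ((a g)^-1 *: b) : 'M_(1 + r)); split.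
- by apply: low_tri_block => //; rewrite mxE oner_eq0.
- rewrite tr_block_mx trmx0; apply: low_tri_block; first by rewrite !mxE mulr1n.
  rewrite linearZ /=; case: h => /is_trig_mxP tb b0; split=> [|i].
    by apply/is_trig_mxP => i j ij; rewrite mxE tb // mulr0.
  by rewrite mxE mulf_neq0 ?invr_eq0.
- rewrite mulmx_block !mul1mx !mul0mx mulmx0 !addr0 -scalemxAr -E /s.
  rewrite -!scalemxAl mul_mx_scalar scalerA mulVf // scale1r.
  rewrite scalerBr scalerA mulVf // scale1r addrC subrK -[g in LHS]submxK.
  congr block_mx; apply/matrixP => i j; rewrite !ord1 !mxE mulr1n.
  by congr (g _ _); apply: val_inj.
Qed.

End TriangularCell.

Section LeftInvariants.
Variables (C : numClosedFieldType) (r : nat).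
Implicit Types (p q : {mpoly C[r * r]}) (g h b : 'M[C]_r) (kappa : 'I_r -> nat).

Definition ev p g : C := p.@[fun l => mxvec g 0 l].

Lemma polyfun_ev p : polyfun (ev p).
Proof.
rewrite /ev; elim/mpoly_alg_ind: p => [c|i|p q IHp IHq|p q IHp IHq].
- by apply: polyfun_ext (polyfun_cst _ c) _ => g; rewrite mevalC.
- by apply: polyfun_linear => a x y; rewrite !mevalXU linearP !mxE.
- by apply: polyfun_ext (polyfunD IHp IHq) _ => g; rewrite mevalD.
- by apply: polyfun_ext (polyfunM IHp IHq) _ => g; rewrite mevalM.
Qed.

Lemma polyfun_evP (f : 'M[C]_r -> C) : polyfun f -> exists p, f =1 ev p.
Proof.
elim=> [c|l|f1 f2 _ [p1 h1] _ [p2 h2]|f1 f2 _ [p1 h1] _ [p2 h2]].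
- by exists c%:MP => g; rewrite /ev mevalC.
- exists (\sum_i \sum_j l (delta_mx i j) *: 'X_(mxvec_index i j)) => g.
  rewrite linear_mxE /ev raddf_sum; apply: eq_bigr => i _.
  rewrite raddf_sum; apply: eq_bigr => j _.
  by rewrite /= mevalZ mevalXU mxvecE mulrC.
- by exists (p1 + p2) => g; rewrite h1 h2 /ev mevalD.
- by exists (p1 * p2) => g; rewrite h1 h2 /ev mevalM.
Qed.

Lemma ev_linear a p q g : ev (a *: p + q) g = a * ev p g + ev q g.
Proof. by rewrite /ev mevalD mevalZ. Qed.

Lemma ev0 g : ev 0 g = 0. Proof. exact: meval0. Qed.

Lemma ev_inj p q : ev p =1 ev q -> p = q.
Proof.
move=> pq; apply/eqP; rewrite -subr_eq0; apply/eqP/meval_inj => v.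
have := pq (vec_mx (\row_l v l)); rewrite /ev vec_mxK => E.
have hv s : s.@[fun l => (\row_l v l) 0 l] = s.@[v].
  by apply: meval_eq => l; rewrite mxE.
by rewrite mevalB -!hv E subrr.
Qed.

Lemma polyfun_unit_eq (f1 f2 : 'M[C]_r -> C) : polyfun f1 -> polyfun f2 ->
  (forall g, g \in unitmx -> f1 g = f2 g) -> f1 =1 f2.
Proof.
move=> p1 p2 h; apply: (@polyfun_eq _ _ _ _ (fun g => \det g) 1%:M) => //.
- by apply: polyfun_det => i j; exact: polyfun_coef.
- by move=> g g0; apply: h; rewrite unitmxE unitfE.
- by rewrite det1 oner_eq0.
Qed.

Lemma ev_unit_inj p q : (forall g, g \in unitmx -> ev p g = ev q g) -> p = q.
Proof. by move=> h; apply: ev_inj; apply: polyfun_unit_eq h; exact: polyfun_ev. Qed.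

Definition rtrans h p : {mpoly C[r * r]} := lsub (lin_mulmxr h) p.

Lemma ev_rtrans h p g : ev (rtrans h p) g = ev p (g *m h).
Proof.
rewrite /ev /rtrans meval_lsub; apply: meval_eq => l.
by rewrite mul_vec_lin.
Qed.

Lemma rtrans_linear h a p q : rtrans h (a *: p + q) = a *: rtrans h p + rtrans h q.
Proof. exact: lsub_linear. Qed.

Lemma rtrans_rtrans h g p : rtrans h (rtrans g p) = rtrans (h *m g) p.
Proof. by apply: ev_inj => x; rewrite !ev_rtrans mulmxA. Qed.

Lemma rtrans1 p : rtrans 1%:M p = p.
Proof. by apply: ev_inj => x; rewrite ev_rtrans mulmx1. Qed.

Lemma adjmxK m n (A : 'M[C]_(m, n)) : adjmx (adjmx A) = A.
Proof. by apply/matrixP => i j; rewrite !mxE conjCK. Qed.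

Lemma adjmxM m n k (A : 'M[C]_(m, n)) (B : 'M[C]_(n, k)) :
  adjmx (A *m B) = adjmx B *m adjmx A.
Proof. by rewrite /adjmx map_mxM trmx_mul. Qed.

Lemma unitmx_adj n (A : 'M[C]_n) : (adjmx A \in unitmx) = (A \in unitmx).
Proof. by rewrite /adjmx unitmx_tr map_unitmx. Qed.

Lemma adjmx_lin_mulmxr h :
  adjmx (lin_mulmxr h : 'M[C]_(r * r, r * r)) = lin_mulmxr (adjmx h).
Proof.
apply/matrixP => k l; case/mxvec_indexP: k => i j; case/mxvec_indexP: l => i' j'.
rewrite !mxE /= !mxvecE !vec_mx_delta /mulmxr /=.
rewrite !mxE (bigD1 j') //= big1 => [|k /negPf kj]; last first.
  by rewrite !mxE kj andbF mul0r.
rewrite [in RHS](bigD1 j) //= [in RHS]big1 => [|k /negPf kj]; last first.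
  by rewrite !mxE kj andbF mul0r.
by rewrite !mxE !eqxx !andbT !addr0 rmorphM /= rmorph_nat [i' == i]eq_sym.
Qed.

Lemma fischer_rtrans h p q : fischer (rtrans h p) q = fischer p (rtrans (adjmx h) q).
Proof. by rewrite {2}/rtrans -adjmx_lin_mulmxr -fischer_lsub. Qed.

Definition semi_inv kappa p := forall b g, low_tri b ->
  ev p (b *m g) = tri_char kappa b * ev p g.

Lemma semi_inv0 kappa : semi_inv kappa 0.
Proof. by move=> b g _; rewrite !ev0 mulr0. Qed.

Lemma semi_inv_linear kappa a p q : semi_inv kappa p -> semi_inv kappa q ->
  semi_inv kappa (a *: p + q).
Proof. by move=> hp hq b g hb; rewrite !ev_linear hp // hq //; ring. Qed.

Lemma semi_inv_rtrans kappa h p : semi_inv kappa p -> semi_inv kappa (rtrans h p).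
Proof. by move=> hp b g hb; rewrite !ev_rtrans -mulmxA hp. Qed.

Lemma mcoeff_lsub_scalar n (s : C) (p : {mpoly C[n]}) m :
  (lsub s%:M p)@_m = s ^+ mdeg m * p@_m.
Proof.
elim/mpolyind: p => [|c k p _ _ IH].
  by rewrite /lsub comp_mpoly0 mcoeff0 mulr0.
rewrite lsub_linear !mcoeffD !mcoeffZ IH mulrDr; congr (_ + _).
rewrite /lsub comp_mpolyX.
rewrite (eq_bigr (fun i => (s ^+ k i) *: ('X_i : {mpoly C[n]}) ^+ k i)).
  rewrite scaler_prod -mpolyXE_id mcoeffZ mcoeffX.
  case: eqP => [<-|_]; last by rewrite !mulr0.
  by rewrite mdegE prodrXr mulrCA.
move=> i _; rewrite tnth_mktuple (bigD1 i) //= big1 => [|j ji].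
  by rewrite mxE eqxx addr0 exprZn.
by rewrite mxE (negPf ji) scale0r.
Qed.

(** Translation by the scalar matrix 2 already determines the degree, as powers of 2 are distinct.
    Hence the semi-invariants form a finite-dimensional space. *)
Lemma semi_inv_mdeg kappa p m : semi_inv kappa p -> m \in msupp p ->
  mdeg m = (\sum_i kappa i)%N.
Proof.
move=> hp mp; pose d := (\sum_i kappa i)%N.
have E : lsub (2%:R%:M) p = 2%:R ^+ d *: p.
  apply: ev_inj => g; rewrite /ev meval_lsub mevalZ -/(ev p g).
  have lt : low_tri (2%:R%:M : 'M[C]_r).
    split=> [|i]; first exact: scalar_mx_is_trig.
    by rewrite mxE eqxx mulr1n pnatr_eq0.
  have := hp _ g lt; rewrite mul_scalar_mx /tri_char.
  rewrite (eq_bigr (fun i => 2%:R ^+ kappa i)); last first.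
    by move=> i _; rewrite mxE eqxx mulr1n.
  rewrite prodrXr => <-; apply: meval_eq => l.
  by rewrite mul_mx_scalar linearZ.
have := congr1 (mcoeff m) E; rewrite mcoeff_lsub_scalar mcoeffZ.
move/mulIf; rewrite -mcoeff_msupp mp => /(_ isT) /eqP.
by rewrite -!natrX eqr_nat eqn_exp2l // => /eqP.
Qed.

End LeftInvariants.

Arguments ev : simpl never.
Arguments rtrans : simpl never.

(** * Representing functionals by the Fischer product *)

Section Riesz.

(** Enlarge a subspace contained in [S] by a missing vector as long as there is one; the dimension
    bounds the process. *)
Lemma closed_prop_vspace (K : fieldType) (V : vectType K) (S : V -> Prop) :
  S 0 -> (forall a x y, S x -> S y -> S (a *: x + y)) ->
  exists U : {vspace V}, forall x, x \in U <-> S x.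
Proof.
move=> S0 SD.
have : exists U : {vspace V}, forall x, x \in U -> S x.
  by exists 0%VS => x; rewrite memv0 => /eqP ->.
case=> U; have [d] := ubnP (\dim {:V} - \dim U).
elim: d U => // d IH U dU US.
have [h|] := pselect (forall x, S x -> x \in U).
  by exists U => x; split; [exact: US | exact: h].
move/existsNP => [x /not_implyP[Sx /negP xU]].
apply: (IH (U + <[x]>)%VS).
  have UUx : (\dim U < \dim (U + <[x]>))%N.
    rewrite ltn_neqAle dimvS ?addvSl // andbT; apply: contra xU => /eqP e.
    have /eqP -> : U == (U + <[x]>)%VS by rewrite eqEdim addvSl -e leqnn.
    by rewrite (subvP (addvSr _ _)) ?memv_line.
  have := dimvS (subvf (U + <[x]>)%VS); lia.
move=> y /memv_addP[u /US Su [z /vlineP[a ->] ->]].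
by rewrite addrC; apply: SD.
Qed.

Variables (C : numClosedFieldType) (n : nat).
Variable S : {mpoly C[n]} -> Prop.
Hypothesis S0 : S 0.
Hypothesis SD : forall a p q, S p -> S q -> S (a *: p + q).
Variable d : nat.
Hypothesis Sd : forall p m, S p -> m \in msupp p -> mdeg m = d.

Lemma closed_prop_sum k (x : 'I_k -> C) (e : 'I_k -> {mpoly C[n]}) :
  (forall i, S (e i)) -> S (\sum_i x i *: e i).
Proof.
move=> Se; elim: (index_enum _) => [|i s IH]; first by rewrite big_nil.
by rewrite big_cons; apply: SD.
Qed.

Lemma closed_prop_basis : exists k (e : 'I_k -> {mpoly C[n]}),
  [/\ forall i, S (e i), forall p, S p -> exists x, p = \sum_i x i *: e i &
      forall x, \sum_i x i *: e i = 0 -> forall i, x i = 0].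
Proof.
pose T := 'X_{1..n < d.+1}; pose M := #|{: T}|.
pose V := 'rV[C]_M.
pose P (x : V) : {mpoly C[n]} := \sum_j x 0 j *: 'X_[enum_val j : T].
have PD a x y : P (a *: x + y) = a *: P x + P y.
  rewrite /P scaler_sumr -big_split; apply: eq_bigr => j _.
  by rewrite !mxE scalerDl scalerA.
have P0 : P 0 = 0 by apply: big1 => j _; rewrite mxE scale0r.
have Pc x (j : 'I_M) : (P x)@_(enum_val j : T) = x 0 j.
  rewrite /P raddf_sum (bigD1 j) //= mcoeffZ mcoeffX eqxx mulr1 big1 ?addr0 // => k kj.
  rewrite mcoeffZ mcoeffX; case: eqP; last by rewrite mulr0.
  move=> /val_inj/enum_val_inj e.
  by rewrite e eqxx in kj.
have Psurj p : S p -> exists x, P x = p.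
  move=> Sp; exists (\row_j p@_(enum_val j : T)); apply/mpolyP => m.
  have [mp|mp] := boolP (m \in msupp p).
    have md : (mdeg m < d.+1)%N by rewrite (Sd Sp mp).
    have -> : m = (enum_val (enum_rank (BMultinom md)) : T) by rewrite enum_rankK.
    by rewrite Pc mxE.
  rewrite (memN_msupp_eq0 mp) /P raddf_sum big1 // => j _ /=.
  rewrite mcoeffZ mcoeffX mxE; case: eqP => [->|_]; last by rewrite mulr0.
  by rewrite (memN_msupp_eq0 mp) mul0r.
have [|a x y Sx Sy|U hU] := @closed_prop_vspace C V (S \o P).
- by rewrite /= P0.
- by rewrite /= PD; apply: SD.
have Psum k (x : 'I_k -> C) (f : 'I_k -> V) :
    P (\sum_i x i *: f i) = \sum_i x i *: P (f i).
  elim: (index_enum _) => [|i s IH]; first by rewrite !big_nil P0.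
  by rewrite !big_cons PD IH.
exists (\dim U), (fun i => P (vbasis U)`_i); split.
- by move=> i; apply/hU; apply: vbasis_mem; rewrite mem_nth // size_tuple.
- move=> p Sp; have [x xp] := Psurj p Sp.
  have xU : x \in U by apply/hU; rewrite /= xp.
  by exists (coord (vbasis U) ^~ x); rewrite -Psum -coord_vbasis.
- move=> x; rewrite -Psum => Px.
  have {Px} : \sum_i x i *: (vbasis U)`_i = 0.
    by apply/rowP => j; rewrite -Pc Px mcoeff0 mxE.
  have /freeP fU := basis_free (vbasisP U).
  exact: fU.
Qed.

Lemma riesz (l : {mpoly C[n]} -> C) :
  (forall a p q, l (a *: p + q) = a * l p + l q) ->
  exists2 kap, S kap & forall p, S p -> fischer p kap = l p.
Proof.
move=> lD; have [k [e [Se Sgen efree]]] := closed_prop_basis.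
have l0 : l 0 = 0.
  by have := lD (-1) 0 0; rewrite scaler0 addr0 mulN1r addNr => ->.
have lsum (x : 'I_k -> C) : l (\sum_i x i *: e i) = \sum_i x i * l (e i).
  elim: (index_enum _) => [|i s IH]; first by rewrite !big_nil.
  by rewrite !big_cons lD IH.
pose G : 'M[C]_k := \matrix_(i, j) fischer (e i) (e j).
have uG : G \in unitmx.
  rewrite unitmxE unitfE; apply/negP => /det0P[x /rV0Pn[i xi] xG].
  case/eqP: xi; apply: (efree (x 0)); apply: fischer_eq0.
  rewrite fischer_sumr big1 // => j _; rewrite fischer_suml.
  have /rowP/(_ j) := xG; rewrite !mxE => E.
  rewrite (eq_bigr (fun i => x 0 i * G i j)) ?E ?mulr0 // => m _.
  by rewrite mxE.
pose y := invmx G *m (\col_i l (e i)).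
exists (\sum_i (y i 0)^* *: e i); first exact: closed_prop_sum.
move=> p /Sgen[x ->]; rewrite fischer_suml lsum; apply: eq_bigr => i _.
congr (_ * _); rewrite fischer_sumr.
have <- : (G *m y) i 0 = l (e i) by rewrite /y mulKVmx // mxE.
rewrite [RHS]mxE; apply: eq_bigr => j _; rewrite conjCK mulrC; congr (_ * _).
by rewrite mxE.
Qed.

End Riesz.

(** * Irreducibility of the space of semi-invariants *)

Section Irreducibility.
Variables (C : numClosedFieldType) (r : nat) (kappa : 'I_r -> nat).
Implicit Types (p q : {mpoly C[r * r]}) (S : {mpoly C[r * r]} -> Prop).

Lemma tri_char_adj (b : 'M[C]_r) : tri_char kappa (adjmx b) = (tri_char kappa b)^*.
Proof. by rewrite rmorph_prod; apply: eq_bigr => i _; rewrite !mxE rmorphXn. Qed.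

Lemma upp_tri_adj (b : 'M[C]_r) : low_tri b^T -> low_tri (adjmx b).
Proof.
move=> [/is_trig_mxP tb b0]; split=> [|i].
  by apply/is_trig_mxP => i j ij; have := tb i j ij; rewrite !mxE => ->; rewrite conjC0.
by have := b0 i; rewrite !mxE conjC_eq0.
Qed.

Lemma low_tri_unit (b : 'M[C]_r) : low_tri b -> b \in unitmx.
Proof. by case=> tb b0; rewrite unitmxE unitfE det_trig //; apply/prodf_neq0. Qed.

Lemma upp_tri_unit (b : 'M[C]_r) : low_tri b^T -> b \in unitmx.
Proof. by move=> /low_tri_unit; rewrite unitmx_tr. Qed.

(* The vector representing the evaluation at 1 is an eigenvector of the upper
   triangular matrices, because evaluation at 1 is one for the lower ones. *)
Lemma ev1_vector S :
  S 0 -> (forall a p q, S p -> S q -> S (a *: p + q)) ->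
  (forall p, S p -> semi_inv kappa p) ->
  (forall h p, h \in unitmx -> S p -> S (rtrans h p)) ->
  exists2 kap, S kap & (forall p, S p -> fischer p kap = ev p 1%:M) /\
    forall b, low_tri b^T -> rtrans b kap = tri_char kappa b *: kap.
Proof.
move=> S0 SD SP St.
have Sdeg p m : S p -> m \in msupp p -> mdeg m = (\sum_i kappa i)%N.
  by move=> /SP; exact: semi_inv_mdeg.
have [kap Sk hk] := riesz (l := fun p => ev p 1%:M) S0 SD Sdeg
  (fun a p q => ev_linear a p q 1%:M).
exists kap => //; split=> // b hb.
apply/eqP; rewrite -subr_eq0; apply/eqP/fischer_eq0.
have ub := upp_tri_unit hb.
set y := _ - _.
have yE : y = - tri_char kappa b *: kap + rtrans b kap by rewrite scaleNr addrC.
have Sy : S y by rewrite yE; apply: SD => //; apply: St.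
have trS : S (rtrans (adjmx b) y) by apply: St => //; rewrite unitmx_adj.
(* The product of [y] with [rtrans b kap] is the value of [y] at [adjmx b]. That matrix is lower
   triangular, so this is the conjugate character times [ev y 1%:M], which cancels the other
   term. *)
rewrite {2}yE fischer_linearr rmorphN /= hk //.
rewrite -[b in rtrans b]adjmxK -fischer_rtrans hk // ev_rtrans mul1mx.
have := SP _ Sy _ 1%:M (upp_tri_adj hb); rewrite mulmx1 => ->.
by rewrite tri_char_adj mulNr addNr.
Qed.

(* The evaluation vector kS of S is proportional to that of all semi-invariants, kP,
   because both are determined by their value at 1 on the dense cell.  So kP is in S,
   and a vector orthogonal to S has all its values zero. *)
Lemma semi_inv_irreducible S :
  S 0 -> (forall a p q, S p -> S q -> S (a *: p + q)) ->
  (forall p, S p -> semi_inv kappa p) ->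
  (forall h p, h \in unitmx -> S p -> S (rtrans h p)) ->
  (exists2 p, S p & p != 0) -> forall p, semi_inv kappa p -> S p.
Proof.
move=> S0 SD SP St [p0 Sp0 p00] p Pp.
have [kS SkS [hkS bkS]] := ev1_vector S0 SD SP St.
have [kP PkP [hkP bkP]] := ev1_vector (@semi_inv0 C r kappa)
  (@semi_inv_linear C r kappa) (fun q h => h)
  (fun h q _ => @semi_inv_rtrans C r kappa h q).
have [f pf [f1 hf]] := low_upp_cell C r.
have prop : ev kP 1%:M *: kS = ev kS 1%:M *: kP.
  apply: ev_inj; apply: polyfun_eq (polyfun_ev _) (polyfun_ev _) pf _ f1 => g.
  move/hf => [b1 [b [h1 h ->]]].
  have evZ a q x : ev (a *: q) x = a * ev q x by rewrite /ev mevalZ.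
  have cell q : semi_inv kappa q -> rtrans b q = tri_char kappa b *: q ->
      ev q (b1 *m b) = tri_char kappa b1 * tri_char kappa b * ev q 1%:M.
    by move=> hq bq; rewrite hq // -[b]mul1mx -ev_rtrans bq evZ mulrA mul1mx.
  rewrite !evZ !cell //; [by ring| exact: bkP | exact: SP | exact: bkS].
have kS1 : ev kS 1%:M != 0.
  apply: contra_neq p00 => k1; have kS0 : kS = 0 by apply: fischer_eq0; rewrite hkS.
  apply: ev_unit_inj => h uh; rewrite ev0 -[h]mul1mx -ev_rtrans -hkS; last exact: St.
  by rewrite kS0 fischer0r.
have SkP : S kP.
  have -> : kP = (ev kP 1%:M / ev kS 1%:M) *: kS + 0.
    by rewrite addr0 mulrC -scalerA prop scalerA mulVf // scale1r.
  exact: SD.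
have Sdeg q m : S q -> m \in msupp q -> mdeg m = (\sum_i kappa i)%N.
  by move=> /SP; exact: semi_inv_mdeg.
(* [k'] is the orthogonal projection of [p] onto [S]. *)
have [k' Sk' hk'] := riesz (l := fun q => fischer q p) S0 SD Sdeg
  (fun a q1 q2 => fischer_linear p a q1 q2).
suff -> : p = k' by [].
apply/eqP; rewrite -subr_eq0; apply/eqP; set q := p - k'.
have qE : q = -1 *: k' + p by rewrite scaleN1r addrC.
have Pq : semi_inv kappa q by rewrite qE; apply: semi_inv_linear => //; exact: SP.
apply: ev_unit_inj => h uh; rewrite ev0 -[h]mul1mx -ev_rtrans -hkP;
  last exact: semi_inv_rtrans.
have Sh : S (rtrans (adjmx h) kP) by apply: St; rewrite ?unitmx_adj.
rewrite fischer_rtrans fischer_herm qE fischer_linearr hk' //.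
by rewrite rmorphN rmorph1 mulN1r addNr conjC0.
Qed.

End Irreducibility.

(** * Existence of irreducible representations *)

Section Existence.
Variables (C : numClosedFieldType) (r : nat).

Lemma mulmx_cV_inj m n (A B : 'M[C]_(m, n)) :
  (forall x : 'cV_n, A *m x = B *m x) -> A = B.
Proof.
move=> AB; apply/matrixP => i j.
by have /matrixP/(_ i 0) := AB (delta_mx j 0); rewrite -!colE !mxE.
Qed.

(** Points are added greedily: fewer than [d] rows kill a common nonzero [y], and some [Psi g] does
    not kill it. The values at the chosen points are then coordinates, which allows
    interpolation. *)
Lemma separating_points (X : Type) d (Psi : X -> 'rV[C]_d) :
  (forall x : 'cV_d, (forall g, Psi g *m x = 0) -> x = 0) ->
  exists pts : 'I_d -> X, (\matrix_i Psi (pts i)) \in unitmx.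
Proof.
move=> inj.
suff H k : (k <= d)%N -> exists pts : 'I_k -> X, row_free (\matrix_i Psi (pts i)).
  by have [pts hp] := H d (leqnn d); exists pts; rewrite -row_free_unit.
elim: k => [|k IH] kd.
  exists (fun i : 'I_0 => False_rect X (notF (ltn_ord i))).
  by rewrite /row_free eqn_leq rank_leq_row.
have [pts fpts] := IH (ltnW kd); set A := \matrix_i _ in fpts.
have : kermx A^T != 0.
  rewrite kermx_eq0 /row_free mxrank_tr (eqP fpts) neq_ltn.
  by rewrite (leq_ltn_trans _ kd).
case/rowV0Pn => y /sub_kermxP yA y0.
have Ay : A *m y^T = 0 by apply: trmx_inj; rewrite trmx_mul trmxK trmx0.
have [g gy] : exists g, Psi g *m y^T != 0.
  apply: contrapT => /forallNP h; case/eqP: y0; apply: trmx_inj; rewrite trmx0.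
  by apply: inj => g; apply/eqP/negPn/negP/h.
exists (fun i => if unlift ord_max i is Some j then pts j else g).
set B := \matrix_i _.
have BE : B *m y^T =
    \col_i (if unlift ord_max i is Some j then 0 else (Psi g *m y^T) 0 0).
  apply/row_matrixP => i; rewrite row_mul rowK; apply/rowP => j.
  rewrite ord1 [RHS]mxE [RHS]mxE; case: unlift => [k'|] //.
  by have /(congr1 (row k')) := Ay; rewrite row_mul rowK row0 => ->; rewrite mxE.
rewrite -kermx_eq0; apply/negPn/negP => /rowV0Pn[c /sub_kermxP cB c0].
have cmax : c 0 ord_max = 0.
  have /matrixP/(_ 0 0) : c *m (B *m y^T) = 0 by rewrite mulmxA cB mul0mx.
  rewrite BE mxE (bigD1 ord_max) //= mxE unlift_none big1 => [|i im].
    rewrite addr0 [RHS]mxE => /eqP; rewrite mulf_eq0 => /predU1P[-> //|/eqP e].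
    by case/eqP: gy; apply/matrixP => i j; rewrite !ord1 e mxE.
  have [k' ->|/esym/eqP] := unliftP ord_max i; last by rewrite eq_sym (negPf im).
  by rewrite mxE liftK mulr0.
case/eqP: c0; pose c' := \row_j c 0 (lift ord_max j).
have c'0 : c' = 0.
  apply: (row_free_inj fpts); rewrite mul0mx; apply/rowP => j.
  have /matrixP/(_ 0 j) := cB; rewrite !mxE => E; rewrite -[RHS]E.
  rewrite [RHS](bigD1_ord ord_max) //= cmax mul0r add0r.
  by apply: eq_bigr => i _; rewrite !mxE liftK.
apply/rowP => i; rewrite mxE; have [k' ->|->] := unliftP ord_max i => //.
by have /rowP/(_ k') := c'0; rewrite !mxE.
Qed.

Definition dominant (kappa : 'I_r -> nat) :=
  forall i j : 'I_r, (i <= j)%N -> (kappa j <= kappa i)%N.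

(** A product of leading principal minors, one for each column of the Young diagram of [kappa]; [k]
    is the height of the first column. *)
Lemma semi_inv_exists kappa : dominant kappa ->
  exists2 p : {mpoly C[r * r]}, semi_inv kappa p & ev p 1%:M = 1.
Proof.
have [d] := ubnP (\sum_i kappa i)%N; elim: d kappa => // d IH kappa kd dom.
have [k0|] := eqVneq (\sum_i kappa i)%N 0%N.
  exists 1; last by rewrite /ev meval1.
  move=> b g _; rewrite /ev !meval1 mulr1 /tri_char big1 // => i _.
  move/eqP: k0; rewrite sum_nat_eq0 => /forallP/(_ i) /= /eqP ->.
  by rewrite expr0.
move=> kn0; pose k := \max_(i | (0 < kappa i)%N) i.+1.
have kr : (k <= r)%N by apply/bigmax_leqP => i _.
have kE (i : 'I_r) : (i < k)%N = (0 < kappa i)%N.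
  apply/idP/idP => [|ki]; last first.
    exact: (@leq_bigmax_cond _ (fun i => 0 < kappa i)%N (fun i : 'I_r => i.+1)).
  apply: contraTT; rewrite -leqNgt leqn0 => /eqP ki; rewrite -leqNgt.
  apply/bigmax_leqP => j kj; rewrite ltnNge; apply/negP => ij.
  by have := dom _ _ ij; rewrite ki leqNgt kj.
pose kappa' i := (kappa i).-1.
have kk' i : kappa i = (ones k i + kappa' i)%N.
  by rewrite /ones kE /kappa'; case: (kappa i).
have [|i j ij|p hp p1] := IH kappa'.
- move: kd; rewrite ltnS; apply: leq_trans.
  have [i ki] : exists i, (0 < kappa i)%N.
    apply/existsP; apply: contraNT kn0; rewrite negb_exists => /forallP h.
    by rewrite big1 // => i _; apply/eqP; rewrite -leqn0 leqNgt h.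
  rewrite (bigD1 i) //= [X in (_ < X)%N](bigD1 i) //= /kappa'.
  rewrite -addSn prednK // leq_add2l.
  by apply: leq_sum => j _; exact: leq_pred.
- by have := dom i j ij; rewrite /kappa'; lia.
pose lead (g : 'M[C]_r) := mxsub (widen_ord kr) (widen_ord kr) g.
have [q hq] : exists q, (fun g => \det (lead g) * ev p g) =1 ev q.
  apply: polyfun_evP; apply: polyfunM (polyfun_ev p); apply: polyfun_det => i j.
  apply: polyfun_ext (polyfun_coef _ (widen_ord kr i) (widen_ord kr j)) _ => g.
  by rewrite mxE.
exists q; last first.
  rewrite -hq p1 mulr1; have -> : lead 1%:M = 1%:M.
    by apply/matrixP => i j; rewrite !mxE.
  by rewrite det1.
move=> b g hb; rewrite -!hq hp // /lead (mxsub_low_tri _ _ _ hb) det_mulmx.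
by rewrite (det_mxsub_low_tri _ hb) (tri_charD _ kk'); ring.
Qed.

Lemma irrep_exists kappa : dominant kappa ->
  exists d (V : 'M[C]_r -> 'M[C]_d), irrep_of_weight kappa V.
Proof.
move=> dom; have [p0 lp0 p01] := semi_inv_exists dom.
have [k [e [le egen efree]]] := closed_prop_basis (@semi_inv0 C r kappa)
  (@semi_inv_linear C r kappa) (@semi_inv_mdeg C r kappa).
pose lc (x : 'cV[C]_k) := \sum_i x i 0 *: e i.
have lclin a x y : lc (a *: x + y) = a *: lc x + lc y.
  rewrite /lc scaler_sumr -big_split; apply: eq_bigr => i _.
  by rewrite !mxE scalerDl scalerA.
have lc0 : lc 0 = 0 by apply: big1 => i _; rewrite mxE scale0r.
have lclinv x : semi_inv kappa (lc x).
  exact: (closed_prop_sum (@semi_inv0 C r kappa) (@semi_inv_linear C r kappa)).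
have lcinj x : lc x = 0 -> x = 0.
  by move=> /efree h; apply/matrixP => i j; rewrite ord1 h mxE.
have lcI x y : lc x = lc y -> x = y.
  move=> exy; apply/eqP; rewrite -subr_eq0; apply/eqP/lcinj.
  by rewrite addrC -scaleN1r lclin exy scaleN1r addNr.
have lcgen p : semi_inv kappa p -> exists x, p = lc x.
  move=> /egen[x ->]; exists (\col_i x i); apply: eq_bigr => i _.
  by rewrite mxE.
have [W hW] : exists W : 'M[C]_r -> 'I_k -> 'cV[C]_k,
    forall h j, rtrans h (e j) = lc (W h j).
  have /choice[W hW] : forall hj : 'M[C]_r * 'I_k,
      exists x, rtrans hj.1 (e hj.2) = lc x.
    by move=> [h j] /=; apply/lcgen/semi_inv_rtrans/le.
  by exists (fun h j => W (h, j)) => h j; rewrite -hW.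
pose V h : 'M[C]_k := \matrix_(i, j) W h j i 0.
have trlc h x : rtrans h (lc x) = lc (V h *m x).
  have -> : V h *m x = \sum_j x j 0 *: W h j.
    apply/matrixP => i j; rewrite mxE ord1 summxE; apply: eq_bigr => l _.
    by rewrite !mxE mulrC.
  rewrite {1}/lc; elim: (index_enum _) => [|i s IH].
    by rewrite !big_nil lc0 /rtrans /lsub comp_mpoly0.
  by rewrite !big_cons rtrans_linear lclin IH hW.
exists k, V; split.
- have V1 : V 1%:M = 1%:M.
    apply/matrixP => i j; rewrite mxE.
    have -> : W 1%:M j = delta_mx j 0.
      apply: lcI; rewrite -hW rtrans1 /lc (bigD1 j) //= mxE !eqxx scale1r.
      rewrite big1 ?addr0 //.
      by move=> l lj; rewrite mxE (negPf lj) scale0r.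
    by rewrite !mxE andbT eq_sym.
  split=> [//|g h _ _|i j].
    apply: mulmx_cV_inj => x; apply: lcI.
    by rewrite -trlc -rtrans_rtrans !trlc mulmxA.
  have [|pts upts] := @separating_points 'M[C]_r k (fun g => \row_j ev (e j) g).
    move=> x hx; apply: lcinj; apply: ev_inj => g; rewrite ev0.
    have /matrixP/(_ 0 0) := hx g; rewrite !mxE => E; rewrite -[RHS]E.
    rewrite /ev raddf_sum; apply: eq_bigr => l _ /=.
    by rewrite mevalZ mxE mulrC.
  set A := \matrix_i _ in upts.
  have pV : polyfun (fun g => V g i j).
    (* Interpolation: the coordinates of the translate of [e j] by [g] are linear in its values at
       [pts], and these are polynomial in [g]. *)
    apply: (@polyfun_ext _ _ (fun g => \sum_l invmx A i l * ev (e j) (pts l *m g))).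
      apply: polyfun_sum => l; apply: polyfunM; first exact: polyfun_cst.
      apply: polyfun_mx (polyfun_ev _) => i' j'.
      by apply: polyfun_linear => a x y; rewrite linearP !mxE.
    move=> g; have -> : V g = invmx A *m (A *m V g) by rewrite mulKmx.
    rewrite [RHS]mxE; apply: eq_bigr => l _; congr (_ * _).
    rewrite -ev_rtrans hW /lc /ev raddf_sum mxE; apply: eq_bigr => l' _ /=.
    by rewrite mevalZ !mxE mulrC.
  have [P hP] := polyfun_evP pV.
  by exists 0%N, P => g _; rewrite hP expr0 divr1.
- split.
    rewrite lt0n; apply/eqP => k0; have [x e0] := lcgen p0 lp0.
    move/eqP: p01; rewrite e0 /lc big1 => [|i _]; last first.
      by have := ltn_ord i; rewrite {2}k0.
    by rewrite ev0 eq_sym oner_eq0.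
  move=> U hU; have [->|U0] := eqVneq U 0%VS; [by left|right].
  apply/eqP; rewrite eqEsubv subvf /=; apply/subvP => x _.
  have [||q [y Uy ->]|h q uh [y Uy ->]||y Uy] := @semi_inv_irreducible C r kappa
    (fun p => exists2 x, x \in U & p = lc x) _ _ _ _ _ (lc x) (lclinv x).
  - by exists 0; rewrite ?mem0v ?lc0.
  - move=> a q1 q2 [y1 U1 ->] [y2 U2 ->]; exists (a *: y1 + y2) => //.
    by rewrite memvD ?memvZ.
  - exact: lclinv.
  - by exists (V h *m y); [exact: hU | exact: trlc].
  - exists (lc (vpick U)); first by exists (vpick U); rewrite ?memv_pick.
    by apply: contraNneq U0 => /lcinj/eqP; rewrite vpick0.
  by move/lcI ->.
- have [kap lkap [hkap bkap]] := ev1_vector (@semi_inv0 C r kappa)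
    (@semi_inv_linear C r kappa) (fun q h => h)
  (fun h q _ => @semi_inv_rtrans C r kappa h q).
  have [v kapE] := lcgen _ lkap; exists v.
  have hb b : low_tri b^T -> V b *m v = tri_char kappa b *: v.
    move=> hb; apply: lcI; rewrite -trlc -kapE bkap //.
    by rewrite -[_ *: v]addr0 lclin lc0 addr0 -kapE.
  split.
  - apply/eqP => v0; move/eqP: p01; rewrite -hkap // kapE v0 lc0 fischer0r.
    by rewrite eq_sym oner_eq0.
  - by move=> t t0; rewrite hb ?tri_char_diag // tr_diag_mx; exact: low_tri_diag.
  - move=> g tg g1; rewrite hb /tri_char; last by split=> // i; rewrite mxE g1 oner_eq0.
    by rewrite big1 ?scale1r // => i _; rewrite g1 expr1n.
Qed.

End Existence.

(** * Irreducible representations as spaces of semi-invariants *)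

Section Model.
Variables (C : numClosedFieldType) (r : nat).

Lemma common_denominator d (V : 'M[C]_r -> 'M[C]_d) : rational_rep V ->
  exists k (P : 'I_d -> 'I_d -> {mpoly C[r * r]}), forall g i j, g \in unitmx ->
    ev (P i j) g = \det g ^+ k * V g i j.
Proof.
case=> _ _ rat.
have /choice[kP hkP] : forall ij : 'I_d * 'I_d, exists kP : nat * {mpoly C[r * r]},
    forall g, g \in unitmx -> V g ij.1 ij.2 = ev kP.2 g / \det g ^+ kP.1.
  by move=> [i j]; have [k [P h]] := rat i j; exists (k, P).
pose k := (\sum_ij (kP ij).1)%N.
have /choice[P hP] : forall ij, exists P,
    (fun g => \det g ^+ (k - (kP ij).1) * ev (kP ij).2 g) =1 ev P.
  move=> ij; apply: polyfun_evP; apply: polyfunM (polyfun_ev _).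
  by apply: polyfunX; apply: polyfun_det => i j; exact: polyfun_coef.
exists k, (fun i j => P (i, j)) => g i j ug.
rewrite -hP (hkP (i, j)) //=.
have d0 : \det g ^+ (kP (i, j)).1 != 0 by rewrite expf_neq0 // -unitfE -unitmxE.
have -> : k = (k - (kP (i, j)).1 + (kP (i, j)).1)%N.
  by rewrite subnK // /k (bigD1 (i, j)) //= leq_addr.
by rewrite addnK exprD -mulrA [_ * (_ / _)]mulrC divfK.
Qed.

Lemma mx_form_inj m n (A B : 'M[C]_(m, n)) :
  (forall (x : 'cV_n) (y : 'cV_m),
    (adjmx y *m A *m x) 0 0 = (adjmx y *m B *m x) 0 0) -> A = B.
Proof.
move=> AB; apply/matrixP => i j; have := AB (delta_mx j 0) (delta_mx i 0).
have -> : adjmx (delta_mx i 0 : 'cV[C]_m) = delta_mx 0 i.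
  by rewrite /adjmx map_delta_mx trmx_delta.
by rewrite -!rowE -!colE !mxE.
Qed.

Lemma det_adjmx n (g : 'M[C]_n) : \det (adjmx g) = (\det g)^*.
Proof. by rewrite /adjmx det_tr det_map_mx. Qed.

Lemma adjmxZ m n a (A : 'M[C]_(m, n)) : adjmx (a *: A) = a^* *: adjmx A.
Proof. by apply/matrixP => i j; rewrite !mxE rmorphM. Qed.

Lemma fischerZl n a (p q : {mpoly C[n]}) : fischer (a *: p) q = a * fischer p q.
Proof. by rewrite -[a *: p]addr0 fischer_linear fischer0l addr0. Qed.

Lemma fischerZr n a (p q : {mpoly C[n]}) : fischer p (a *: q) = a^* * fischer p q.
Proof. by rewrite -[a *: q]addr0 fischer_linearr fischer0r addr0. Qed.

Lemma hwv_upp_tri d (V : 'M[C]_r -> 'M[C]_d) kappa v b :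
  rational_rep V -> highest_weight_vector V kappa v -> low_tri b^T ->
  V b *m v = tri_char kappa b *: v.
Proof.
case=> _ VM _ [_ vt vn] hb.
have b0 i : b i i != 0 by have [_ /(_ i)] := hb; rewrite mxE.
pose t : 'rV[C]_r := \row_i b i i; pose t' : 'rV[C]_r := \row_i (b i i)^-1.
have t0 i : t 0 i != 0 by rewrite mxE.
have t'0 i : t' 0 i != 0 by rewrite mxE invr_eq0.
have bE : b = diag_mx t *m (diag_mx t' *m b).
  by apply/matrixP => i j; rewrite !mul_diag_mx !mxE mulrA divff ?mul1r.
have tn : low_tri (diag_mx t' *m b)^T.
  by rewrite trmx_mul tr_diag_mx; apply: low_tri_mul => //; exact: low_tri_diag.
rewrite {1}bE VM; last 2 first.
- exact/low_tri_unit/low_tri_diag.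
- exact: upp_tri_unit.
rewrite -mulmxA vn; first 1 last.
- by case: tn.
- by move=> i; rewrite mul_diag_mx !mxE mulVf.
rewrite vt //; congr (_ *: _); apply: eq_bigr => i _.
by rewrite mxE.
Qed.

Lemma det_low_tri b : @low_tri C r b -> \det b = tri_char (fun=> 1%N) b.
Proof. by case=> tb _; rewrite det_trig //; apply: eq_bigr => i _; rewrite expr1. Qed.

Lemma tri_char_shift kappa k b : @low_tri C r b ->
  tri_char (fun i => k + kappa i)%N b = \det b ^+ k * tri_char kappa b.
Proof.
move=> hb; rewrite (@tri_charD _ _ (fun=> k) kappa) //; congr (_ * _).
by rewrite det_low_tri // -prodrXl; apply: eq_bigr => i _; rewrite expr1.
Qed.

Lemma irreducible_rep_ker d (V : 'M[C]_r -> 'M[C]_d) (S : 'cV[C]_d -> Prop) :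
  irreducible_rep V -> S 0 -> (forall a x y, S x -> S y -> S (a *: x + y)) ->
  (forall g x, g \in unitmx -> S x -> S (V g *m x)) ->
  (exists x, ~ S x) -> forall x, S x -> x = 0.
Proof.
move=> [_ irr] S0 SD SV [y Sy] x Sx; have [U hU] := closed_prop_vspace S0 SD.
have [|U0|UT] := irr U; first by move=> g z ug /hU Sz; apply/hU/SV.
  by apply/eqP; rewrite -memv0 -U0; apply/hU.
by case: Sy; apply/hU; rewrite UT memvf.
Qed.

(* The last two clauses identify V with the space of left semi-invariants of weight
   kappa, acted upon by right translations. *)
Definition model kappa d (V : 'M[C]_r -> 'M[C]_d) v (H : 'M[C]_d)
    (Psi : 'M[C]_r -> 'rV[C]_d) :=
  [/\ H \in unitmx /\ adjmx H = H,
      forall g, g \in unitmx -> H *m V g = adjmx (V (adjmx g)) *m H,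
      (forall j, polyfun (fun g => Psi g 0 j)) /\
      (forall b g, low_tri b -> Psi (b *m g) = tri_char kappa b *: Psi g),
      forall g, g \in unitmx -> Psi g = adjmx v *m H *m V g &
      (forall x : 'cV_d, (forall g, Psi g *m x = 0) -> x = 0) /\
      (forall f : 'M[C]_r -> C, polyfun f ->
        (forall b g, low_tri b -> f (b *m g) = tri_char kappa b * f g) ->
        exists x : 'cV_d, forall g, f g = (Psi g *m x) 0 0)].

(** [Phi l x] is the matrix coefficient of [l] and [x] cleared of its denominator. For a suitable
    [l] these are left semi-invariants; irreducibility of [V] makes [Phi l] injective, and that of
    the semi-invariants makes it surjective. *)
Lemma irrep_model kappa d (V : 'M[C]_r -> 'M[C]_d) v :
  dominant kappa -> rational_rep V -> irreducible_rep V ->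
  highest_weight_vector V kappa v -> exists H Psi, model kappa V v H Psi.
Proof.
move=> dom rat irr hwv.
have [k [P hP]] := common_denominator rat.
have [V1 VM _] := rat; have [d0 _] := irr; have [v0 _ _] := hwv.
have det0 (g : 'M[C]_r) : g \in unitmx -> \det g ^+ k != 0.
  by move=> ug; rewrite expf_neq0 // -unitfE -unitmxE.
pose Phi (l : 'rV[C]_d) (x : 'cV[C]_d) := \sum_i \sum_j (l 0 i * x j 0) *: P i j.
have evPhi l x g : g \in unitmx -> ev (Phi l x) g = \det g ^+ k * (l *m V g *m x) 0 0.
  move=> ug; rewrite -mulmxA mxE mulr_sumr /ev raddf_sum; apply: eq_bigr => i _.
  rewrite raddf_sum mxE mulr_sumr mulr_sumr; apply: eq_bigr => j _ /=.
  by rewrite mevalZ -/(ev _ _) hP //; ring.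
have PhiD l a x y : Phi l (a *: x + y) = a *: Phi l x + Phi l y.
  apply: ev_unit_inj => g ug; rewrite ev_linear !evPhi //.
  by rewrite mulmxDr -scalemxAr !mxE mulrDr mulrCA.
have Phi0 l : Phi l 0 = 0.
  by apply: ev_unit_inj => g ug; rewrite evPhi // mulmx0 mxE mulr0 ev0.
have trPhi l h x : h \in unitmx -> rtrans h (Phi l x) = \det h ^+ k *: Phi l (V h *m x).
  move=> uh; apply: ev_unit_inj => g ug; rewrite ev_rtrans /ev mevalZ -!/(ev _ _).
  rewrite !evPhi ?unitmx_mul ?ug // VM // det_mulmx exprMn !mulmxA; ring.
have Phiinj l x : l != 0 -> Phi l x = 0 -> x = 0.
  move=> l0; apply: (@irreducible_rep_ker _ V (fun x => Phi l x = 0) irr (Phi0 l)).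
  - by move=> a y z hy hz; rewrite PhiD hy hz scaler0 addr0.
  - move=> g y ug hy; apply/eqP; have := trPhi l g y ug; rewrite hy.
    rewrite /rtrans /lsub comp_mpoly0 => /esym/eqP.
    by rewrite scaler_eq0 (negPf (det0 _ ug)).
  have [j lj] := rV0Pn _ l0; exists (delta_mx j 0) => h.
  have := evPhi l (delta_mx j 0) 1%:M (unitmx1 _ _); rewrite h ev0 V1 det1 expr1n mul1r.
  by rewrite mulmx1 -colE mxE => /esym/eqP; rewrite (negPf lj).
(* Any nonzero row pulls the Fischer product back to a contravariant form [H]; the row [l] that
   gives semi-invariants can only be defined once [H] is available. *)
pose l0 : 'rV[C]_d := delta_mx 0 (Ordinal d0).
have l00 : l0 != 0.
  by apply/rV0Pn; exists (Ordinal d0); rewrite mxE !eqxx oner_eq0.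
pose H : 'M[C]_d :=
  \matrix_(i, j) fischer (Phi l0 (delta_mx j 0)) (Phi l0 (delta_mx i 0)).
have PhiE x : Phi l0 x = \sum_j x j 0 *: Phi l0 (delta_mx j 0).
  have {1}-> : x = \sum_j x j 0 *: (delta_mx j 0 : 'cV[C]_d).
    by rewrite {1}[x]matrix_sum_delta; apply: eq_bigr => i _; rewrite big_ord1.
  elim: (index_enum _) => [|j s IH]; first by rewrite !big_nil Phi0.
  by rewrite !big_cons PhiD IH.
have HE x y : (adjmx y *m H *m x) 0 0 = fischer (Phi l0 x) (Phi l0 y).
  rewrite (PhiE x) (PhiE y) fischer_suml mxE; apply: eq_bigr => j _.
  rewrite mulrC; congr (_ * _); rewrite fischer_sumr mxE.
  by apply: eq_bigr => i _; rewrite !mxE.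
have Hinj (x : 'cV[C]_d) : H *m x = 0 -> x = 0.
  move=> Hx; apply: (Phiinj l0 x l00); apply: fischer_eq0.
  by rewrite -HE -mulmxA Hx mulmx0 mxE.
have uH : H \in unitmx.
  rewrite -unitmx_tr -row_free_unit -kermx_eq0; apply/negPn/negP => /rowV0Pn[y].
  move/sub_kermxP => yH /eqP[]; apply: trmx_inj; rewrite trmx0; apply: Hinj.
  by apply: trmx_inj; rewrite trmx_mul trmxK trmx0.
have aH : adjmx H = H.
  by apply/matrixP => i j; rewrite !mxE [in RHS]fischer_herm.
have cH g : g \in unitmx -> H *m V g = adjmx (V (adjmx g)) *m H.
  move=> ug; apply: mx_form_inj => x y.
  have uag : adjmx g \in unitmx by rewrite unitmx_adj.
  rewrite !mulmxA -adjmxM HE -[_ *m V g *m x]mulmxA HE.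
  apply: (mulfI (det0 g ug)); rewrite -fischerZl -trPhi // fischer_rtrans trPhi //.
  by rewrite fischerZr det_adjmx rmorphXn /= conjCK.
(* Contravariance moves a lower triangular [b] to the upper triangular [adjmx b] acting on [v], for
   which [v] is an eigenvector. *)
pose l := adjmx v *m H.
have l_n0 : l != 0.
  apply: contraNneq v0 => l_0; have : adjmx l = 0 by rewrite l_0 /adjmx map_mx0 trmx0.
  by rewrite /l adjmxM adjmxK aH => /Hinj ->.
have lV b : low_tri b -> l *m V b = tri_char kappa b *: l.
  move=> hb; have ub := low_tri_unit hb.
  have hb' : low_tri (adjmx b)^T.
    rewrite -[b]trmxK in hb; have := upp_tri_adj hb.
    by rewrite /adjmx map_trmx !trmxK.
  rewrite /l -mulmxA cH // mulmxA -adjmxM (hwv_upp_tri rat hwv hb').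
  by rewrite tri_char_adj adjmxZ conjCK -scalemxAl.
pose kappa' i := (k + kappa i)%N.
have Phi_linv x : semi_inv kappa' (Phi l x).
  move=> b g hb; have ub := low_tri_unit hb.
  move: g; apply: polyfun_unit_eq.
  - apply: polyfun_mx (polyfun_ev _) => i j.
    by apply: polyfun_linear => a y z; rewrite linearP !mxE.
  - by apply: polyfunM (polyfun_ev _); exact: polyfun_cst.
  move=> g ug; rewrite !evPhi ?unitmx_mul ?ub // VM // (tri_char_shift _ _ hb).
  rewrite det_mulmx exprMn mulmxA lV // -!scalemxAl mxE; ring.
have Phi_surj p : semi_inv kappa' p -> exists x, p = Phi l x.
  apply: (@semi_inv_irreducible C r kappa' (fun p => exists x, p = Phi l x)).
  - by exists 0.
  - by move=> a p1 p2 [x ->] [y ->]; exists (a *: x + y).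
  - by move=> _ [x ->].
  - move=> h _ uh [x ->]; exists (\det h ^+ k *: (V h *m x) + 0).
    by rewrite PhiD Phi0 addr0 trPhi.
  - exists (Phi l v); first by exists v.
    by apply: contra_neq v0; exact: Phiinj.
have [p0 lp0 p01] := semi_inv_exists C dom.
(* The semi-invariants of shifted weight divisible by [\det g ^+ k] form an invariant space, nonzero
   because [kappa] is dominant, hence contain every [Phi l x]. The quotients are the entries of
   [Psi]. *)
pose S (q : {mpoly C[r * r]}) := semi_inv kappa' q /\
  exists2 p : {mpoly C[r * r]}, semi_inv kappa p &
  forall g, ev q g = \det g ^+ k * ev p g.
have pdetk : polyfun (fun g : 'M[C]_r => \det g ^+ k).
  by apply: polyfunX; apply: polyfun_det => i j; exact: polyfun_coef.
have semi_inv_shift (p q : {mpoly C[r * r]}) : semi_inv kappa p ->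
    (forall g, ev q g = \det g ^+ k * ev p g) -> semi_inv kappa' q.
  move=> hp qE b g hb; rewrite !qE hp // det_mulmx exprMn (tri_char_shift _ _ hb).
  by ring.
have S_all (q : {mpoly C[r * r]}) : semi_inv kappa' q -> S q.
  apply: semi_inv_irreducible.
  - split; first exact: semi_inv0.
    by exists 0; [exact: semi_inv0 | move=> g; rewrite !ev0 mulr0].
  - move=> a q1 q2 [l1 [p1 lp1 E1]] [l2 [p2 lp2 E2]].
    split; first exact: semi_inv_linear.
    exists (a *: p1 + p2); first exact: semi_inv_linear.
    by move=> g; rewrite !ev_linear E1 E2; ring.
  - by move=> q1 [].
  - move=> h q1 uh [l1 [p1 lp1 E1]]; split; first exact: semi_inv_rtrans.
    exists (\det h ^+ k *: rtrans h p1 + 0).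
      by apply: semi_inv_linear; [exact: semi_inv_rtrans | exact: semi_inv0].
    move=> g; rewrite ev_linear !ev_rtrans E1 ev0 det_mulmx exprMn; ring.
  - have [q0 q0E] := polyfun_evP (polyfunM pdetk (polyfun_ev p0)).
    exists q0; first by split; [exact: semi_inv_shift lp0 _ | exists p0].
    apply/eqP => q00; have := q0E 1%:M; rewrite q00 ev0 p01 det1 expr1n mulr1.
    by move/eqP; rewrite oner_eq0.
have /choice[psi hpsi] : forall j, exists p, semi_inv kappa p /\
    forall g, ev (Phi l (delta_mx j 0)) g = \det g ^+ k * ev p g.
  by move=> j; have [_ [p]] := S_all _ (Phi_linv (delta_mx j 0)); exists p.
pose Psi g : 'rV[C]_d := \row_j ev (psi j) g.
have PsiE g : g \in unitmx -> Psi g = l *m V g.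
  move=> ug; apply/rowP => j; apply: (mulfI (det0 g ug)).
  by rewrite mxE -(hpsi j).2 evPhi // -colE mxE.
have pPsi (x : 'cV[C]_d) : polyfun (fun g => (Psi g *m x) 0 0).
  apply: (@polyfun_ext _ _ (fun g => \sum_j ev (psi j) g * x j 0)).
    by apply: polyfun_sum => j; apply: polyfunM (polyfun_ev _) (polyfun_cst _ _).
  by move=> g; rewrite [RHS]mxE; apply: eq_bigr => j _; rewrite mxE.
exists H, Psi; split=> //.
- split=> [j|b g hb].
    by apply: polyfun_ext (polyfun_ev (psi j)) _ => g; rewrite mxE.
  by apply/rowP => j; rewrite !mxE (hpsi j).1.
split=> [x hx|f pf hf].
  apply: (Phiinj l x l_n0); apply: ev_unit_inj => g ug.
  by rewrite evPhi // -PsiE // hx mxE mulr0 ev0.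
have [p pE] := polyfun_evP pf.
have [q qE] := polyfun_evP (polyfunM pdetk pf).
have lp : semi_inv kappa p by move=> b g hb; rewrite -!pE hf.
have [x qx] : exists x, q = Phi l x.
  by apply: Phi_surj; apply: semi_inv_shift lp _ => g; rewrite -qE pE.
exists x; apply: (polyfun_unit_eq pf (pPsi x)) => g ug.
by apply: (mulfI (det0 g ug)); rewrite qE qx evPhi // PsiE.
Qed.

End Model.

(** * Homomorphisms into a tensor product *)

Section Homomorphisms.
Variables (C : numClosedFieldType) (r : nat).

Lemma adjmx_tens m n p q (A : 'M[C]_(m, n)) (B : 'M[C]_(p, q)) :
  adjmx (A *t B) = adjmx A *t adjmx B.
Proof. by rewrite /adjmx map_mxT trmx_tens. Qed.

Lemma tensmxZ m n p q a b (A : 'M[C]_(m, n)) (B : 'M[C]_(p, q)) :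
  (a *: A) *t (b *: B) = (a * b) *: (A *t B).
Proof. by apply/matrixP => i j; rewrite !mxE; ring. Qed.

Lemma polyfun_right_mul (f : 'M[C]_r -> C) (h : 'M[C]_r) :
  polyfun f -> polyfun (fun g => f (g *m h)).
Proof.
move=> pf; apply: polyfun_mx pf => i j; apply: polyfun_linear => a x y.
by rewrite mulmxDl -scalemxAl !mxE.
Qed.

Lemma polyfun_left_mul (f : 'M[C]_r -> C) (h : 'M[C]_r) :
  polyfun f -> polyfun (fun g => f (h *m g)).
Proof.
move=> pf; apply: polyfun_mx pf => i j; apply: polyfun_linear => a x y.
by rewrite mulmxDr -scalemxAr !mxE.
Qed.

Section OneModel.
Variables (kappa : 'I_r -> nat) (d : nat) (V : 'M[C]_r -> 'M[C]_d) (v : 'cV[C]_d).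
Variables (H : 'M[C]_d) (Psi : 'M[C]_r -> 'rV[C]_d).
Hypotheses (rat : rational_rep V) (hm : model kappa V v H Psi).

Lemma model_right g h : h \in unitmx -> Psi (g *m h) = Psi g *m V h.
Proof.
have [_ VM _] := rat; have [_ _ [pPsi _] PsiE _] := hm.
move=> uh; apply/rowP => j; move: g; apply: polyfun_unit_eq.
- exact: (polyfun_right_mul h (pPsi j)).
- apply: (@polyfun_ext _ _ (fun g => \sum_i Psi g 0 i * V h i j)) => [|g].
    by apply: polyfun_sum => i; apply: polyfunM => //; exact: polyfun_cst.
  by rewrite [RHS]mxE.
move=> g ug; congr (_ 0 j); rewrite !PsiE ?unitmx_mul ?ug //.
by rewrite VM // mulmxA.
Qed.

Lemma model_points : exists pts : 'I_d -> 'M[C]_r,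
  (\matrix_i Psi (pts i)) \in unitmx.
Proof. by have [_ _ _ _ [inj _]] := hm; exact: separating_points. Qed.

Lemma model_eq_points (pts : 'I_d -> 'M[C]_r) (f : 'M[C]_r -> C) :
  (\matrix_i Psi (pts i)) \in unitmx -> polyfun f ->
  (forall b g, low_tri b -> f (b *m g) = tri_char kappa b * f g) ->
  (forall i, f (pts i) = 0) -> forall g, f g = 0.
Proof.
move=> upts pf hf f0 g; have [_ _ _ _ [_ surj]] := hm.
have [x fx] := surj f pf hf; rewrite fx.
suff -> : x = 0 by rewrite mulmx0 mxE.
rewrite -[x](mulKmx upts); suff -> : \matrix_i Psi (pts i) *m x = 0 by rewrite mulmx0.
apply/row_matrixP => i; rewrite row_mul rowK row0; apply/rowP => j.
by rewrite ord1 -fx f0 mxE.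
Qed.

(** Interpolation at the points of the model. The values at singular matrices allow matrix
    coefficients of [V] to be treated as polynomial functions. *)
Lemma model_polynomial : exists W : 'M[C]_r -> 'M[C]_d,
  (forall i j, polyfun (fun g => W g i j)) /\
  forall g, g \in unitmx -> V g = W g.
Proof.
have [pts upts] := model_points; have [_ _ [pPsi _] _ _] := hm.
set M := \matrix_i _ in upts.
exists (fun g => invmx M *m \matrix_i Psi (pts i *m g)); split=> [i j|g ug].
  apply: (@polyfun_ext _ _ (fun g => \sum_k invmx M i k * Psi (pts k *m g) 0 j)).
    apply: polyfun_sum => k; apply: polyfunM; first exact: polyfun_cst.
    exact: (polyfun_left_mul _ (pPsi j)).
  by move=> g; rewrite [RHS]mxE; apply: eq_bigr => k _; rewrite [in RHS]mxE.
rewrite -[LHS](mulKmx upts); congr (_ *m _); apply/row_matrixP => i.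
by rewrite row_mul !rowK model_right.
Qed.

End OneModel.

Variables (lambda mu nu : 'I_r -> nat) (d1 d2 d3 : nat).
Variables (V1 : 'M[C]_r -> 'M[C]_d1) (V2 : 'M[C]_r -> 'M[C]_d2)
  (V3 : 'M[C]_r -> 'M[C]_d3).
Variables (v1 : 'cV[C]_d1) (v2 : 'cV[C]_d2) (v3 : 'cV[C]_d3).
Variables (H1 : 'M[C]_d1) (H2 : 'M[C]_d2) (H3 : 'M[C]_d3).
Variables (Psi1 : 'M[C]_r -> 'rV[C]_d1) (Psi2 : 'M[C]_r -> 'rV[C]_d2)
  (Psi3 : 'M[C]_r -> 'rV[C]_d3).
Hypotheses (rat1 : rational_rep V1) (rat2 : rational_rep V2) (rat3 : rational_rep V3).
Hypotheses (d1_gt0 : (0 < d1)%N) (d2_gt0 : (0 < d2)%N) (irr3 : irreducible_rep V3).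
Hypothesis hwv3 : highest_weight_vector V3 nu v3.
Hypotheses (hm1 : model lambda V1 v1 H1 Psi1) (hm2 : model mu V2 v2 H2 Psi2)
  (hm3 : model nu V3 v3 H3 Psi3).

Local Notation T := (tensor_rep V1 V2).

Definition equivariant (A : 'M[C]_(d1 * d2, d3)) :=
  forall g, g \in unitmx -> A *m V3 g = T g *m A.

(** The identification of the tensor product with left semi-invariants on pairs of matrices;
    [mxtens_index (0, 0)] is the only row. *)
Definition tensor_coef (w : 'cV[C]_(d1 * d2)) (x : 'M[C]_r * 'M[C]_r) : C :=
  ((Psi1 x.1 *t Psi2 x.2) *m w) (mxtens_index (0, 0)) 0.

Lemma tensor_coef_linear a w w' x :
  tensor_coef (a *: w + w') x = a * tensor_coef w x + tensor_coef w' x.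
Proof. by rewrite /tensor_coef mulmxDr -scalemxAr !mxE. Qed.

Lemma tensor_coef_poly w : polyfun (tensor_coef w).
Proof.
have [_ _ [p1 _] _ _] := hm1; have [_ _ [p2 _] _ _] := hm2.
apply: (@polyfun_ext _ _ (fun x : 'M[C]_r * 'M[C]_r => \sum_k
  Psi1 x.1 0 (mxtens_unindex k).1 * Psi2 x.2 0 (mxtens_unindex k).2 * w k 0)).
  apply: polyfun_sum => k; apply: polyfunM; last exact: polyfun_cst.
  by apply: polyfunM; [move: (p1 (mxtens_unindex k).1)|move: (p2 (mxtens_unindex k).2)];
    apply: polyfun_mx => i j; apply: polyfun_linear => a x y; rewrite !mxE.
move=> x; rewrite /tensor_coef [RHS]mxE; apply: eq_bigr => k _.
by rewrite !mxE mxtens_indexK.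
Qed.

Lemma tensor_coef_left w b1 b2 g1 g2 : low_tri b1 -> low_tri b2 ->
  tensor_coef w (b1 *m g1, b2 *m g2)
  = tri_char lambda b1 * tri_char mu b2 * tensor_coef w (g1, g2).
Proof.
have [_ _ [_ l1] _ _] := hm1; have [_ _ [_ l2] _ _] := hm2 => hb1 hb2.
by rewrite /tensor_coef /= l1 // l2 // tensmxZ -scalemxAl mxE.
Qed.

Lemma tensor_coef_right w g1 g2 h : h \in unitmx ->
  tensor_coef w (g1 *m h, g2 *m h) = tensor_coef (T h *m w) (g1, g2).
Proof.
move=> uh; rewrite /tensor_coef /= (model_right rat1 hm1) // (model_right rat2 hm2) //.
by rewrite -tensmx_mul mulmxA.
Qed.

Lemma tensor_coef_points (pts1 : 'I_d1 -> 'M[C]_r) (pts2 : 'I_d2 -> 'M[C]_r) w i j :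
  ((\matrix_k Psi1 (pts1 k)) *t (\matrix_k Psi2 (pts2 k)) *m w) (mxtens_index (i, j)) 0
  = tensor_coef w (pts1 i, pts2 j).
Proof.
rewrite /tensor_coef [LHS]mxE [RHS]mxE; apply: eq_bigr => k _; congr (_ * _).
by rewrite !mxE !mxtens_indexK.
Qed.

Lemma tensor_coef_inj w : (forall x, tensor_coef w x = 0) -> w = 0.
Proof.
move=> w0; have [pts1 u1] := model_points hm1; have [pts2 u2] := model_points hm2.
have u12 : ((\matrix_k Psi1 (pts1 k)) *t (\matrix_k Psi2 (pts2 k))) \in unitmx.
  by apply: tensmx_unit; rewrite -?lt0n.
rewrite -[w](mulKmx u12); set z := (_ *m w); suff -> : z = 0 by rewrite mulmx0.
apply/colP => k; rewrite -[k]mxtens_unindexK; case: (mxtens_unindex k) => i j.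
by rewrite /z tensor_coef_points w0 mxE.
Qed.

(** Choose [w] to agree with [F] on a grid of interpolation points. The difference then vanishes
    identically in the first variable at each second grid point, and after that in the second
    variable. *)
Lemma tensor_coef_surj (F : 'M[C]_r * 'M[C]_r -> C) : polyfun F ->
  (forall b1 b2 g1 g2, low_tri b1 -> low_tri b2 ->
    F (b1 *m g1, b2 *m g2) = tri_char lambda b1 * tri_char mu b2 * F (g1, g2)) ->
  exists w, forall x, F x = tensor_coef w x.
Proof.
move=> pF hF; have [pts1 u1] := model_points hm1; have [pts2 u2] := model_points hm2.
have u12 : ((\matrix_k Psi1 (pts1 k)) *t (\matrix_k Psi2 (pts2 k))) \in unitmx.
  by apply: tensmx_unit; rewrite -?lt0n.
pose z : 'cV[C]_(d1 * d2) :=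
  \col_k F (pts1 (mxtens_unindex k).1, pts2 (mxtens_unindex k).2).
pose w := invmx (\matrix_k Psi1 (pts1 k) *t \matrix_k Psi2 (pts2 k)) *m z.
have wE i j : F (pts1 i, pts2 j) = tensor_coef w (pts1 i, pts2 j).
  by rewrite -tensor_coef_points mulKVmx // mxE mxtens_indexK.
pose D x := F x - tensor_coef w x.
have pD : polyfun D by apply: polyfunB pF (tensor_coef_poly w).
have D1 j g1 : D (g1, pts2 j) = 0.
  apply: (model_eq_points hm1 u1 (f := fun g => D (g, pts2 j))) => [|b g hb|i].
  - apply: polyfun_pair pD => i k; first exact: polyfun_coef.
    exact: polyfun_cst.
  - have h1 := low_tri1 C r; rewrite /D -[pts2 j]mul1mx hF // tensor_coef_left //.
    by rewrite tri_char1 !mul1mx; ring.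
  - by rewrite /D wE subrr.
exists w => -[g1 g2]; apply/eqP; rewrite -subr_eq0; apply/eqP.
apply: (model_eq_points hm2 u2 (f := fun g => D (g1, g))) => [|b g hb|j].
- apply: polyfun_pair pD => i k; first exact: polyfun_cst.
  exact: polyfun_coef.
- have h1 := low_tri1 C r; rewrite /D -[g1]mul1mx hF // tensor_coef_left //.
  by rewrite tri_char1 !mul1mx; ring.
- exact: D1.
Qed.

Lemma tensor_repM g h : g \in unitmx -> h \in unitmx -> T (g *m h) = T g *m T h.
Proof.
have [_ M1 _] := rat1; have [_ M2 _] := rat2 => ug uh.
by rewrite /tensor_rep M1 // M2 // tensmx_mul.
Qed.

Lemma hom_semi_inv2 A : equivariant A -> semi_inv2 lambda mu nu (tensor_coef (A *m v3)).
Proof.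
move=> eA; split=> [|b1 b2 b g1 g2 h1 h2 h]; first exact: tensor_coef_poly.
have ub := upp_tri_unit h.
rewrite -!mulmxA tensor_coef_left // tensor_coef_right // mulmxA -eA // -mulmxA.
rewrite (hwv_upp_tri rat3 hwv3 h) -scalemxAr /tensor_coef -scalemxAr mxE; ring.
Qed.

Lemma hom_inj A : equivariant A -> (forall x, tensor_coef (A *m v3) x = 0) -> A = 0.
Proof.
move=> eA /tensor_coef_inj Av; have [v30 _ _] := hwv3.
apply: contrapT => A0; case/eqP: v30.
apply: (@irreducible_rep_ker _ _ _ V3 (fun x => A *m x = 0) irr3) => //.
- exact: mulmx0.
- by move=> a x y hx hy; rewrite mulmxDr -scalemxAr hx hy scaler0 addr0.
- by move=> g x ug hx; rewrite mulmxA eA // -mulmxA hx mulmx0.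
- apply: contrapT => h; apply: A0; apply: mulmx_cV_inj => x; rewrite mul0mx.
  by apply: contrapT => hx; apply: h; exists x.
Qed.

(* A highest weight vector w of the tensor product defines a map B from the tensor
   product to V3, by Psi3 g (B y) = <T g y, w>; the homomorphism from V3 with v3 |-> w
   is its adjoint. *)
Lemma hwv_hom w : (forall b, low_tri b^T -> T b *m w = tri_char nu b *: w) ->
  exists2 A, equivariant A & A *m v3 = w.
Proof.
move=> hw.
have [[uH1 aH1] cH1 _ _ _] := hm1; have [[uH2 aH2] cH2 _ _ _] := hm2.
have [[uH3 aH3] cH3 [pPsi3 _] PsiE3 [inj3 surj3]] := hm3.
have [W1 [pW1 W1E]] := model_polynomial rat1 hm1.
have [W2 [pW2 W2E]] := model_polynomial rat2 hm2.
have [V31 V3M _] := rat3.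
pose H := H1 *t H2.
have uH : H \in unitmx by apply: tensmx_unit; rewrite -?lt0n.
have aH : adjmx H = H by rewrite /H adjmx_tens aH1 aH2.
have cH g : g \in unitmx -> H *m T g = adjmx (T (adjmx g)) *m H.
  by move=> ug; rewrite /H /tensor_rep tensmx_mul cH1 // cH2 // adjmx_tens tensmx_mul.
pose f (y : 'cV[C]_(d1 * d2)) g := (adjmx w *m H *m (W1 g *t W2 g) *m y) 0 0.
have fE y g : g \in unitmx -> f y g = (adjmx w *m H *m T g *m y) 0 0.
  by move=> ug; rewrite /f /tensor_rep W1E // W2E.
have pf y : polyfun (f y).
  apply: (@polyfun_ext _ _ (fun g => \sum_j (\sum_i (adjmx w *m H) 0 i *
     (W1 g (mxtens_unindex i).1 (mxtens_unindex j).1 *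
      W2 g (mxtens_unindex i).2 (mxtens_unindex j).2)) * y j 0)).
    apply: polyfun_sum => j; apply: polyfunM; last exact: polyfun_cst.
    apply: polyfun_sum => i; apply: polyfunM; first exact: polyfun_cst.
    exact: polyfunM.
  move=> g; rewrite [RHS]mxE; apply: eq_bigr => j _; congr (_ * _).
  rewrite [RHS]mxE; apply: eq_bigr => i _; congr (_ * _).
  by rewrite [RHS]mxE.
have /choice[x hx] : forall j : 'I_(d1 * d2), exists x : 'cV[C]_d3, forall g,
    f (delta_mx j 0) g = (Psi3 g *m x) 0 0.
  move=> j; apply: surj3 => // b g hb; have ub := low_tri_unit hb.
  move: g; apply: polyfun_unit_eq.
  - exact: polyfun_left_mul.
  - by apply: polyfunM (pf _); exact: polyfun_cst.
  move=> g ug; rewrite !fE ?unitmx_mul ?ub // tensor_repM //.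
  have hb' : low_tri (adjmx b)^T.
    rewrite -[b]trmxK in hb; have := upp_tri_adj hb.
    by rewrite /adjmx map_trmx !trmxK.
  rewrite !mulmxA -[_ *m H *m T b]mulmxA cH // mulmxA -adjmxM hw //.
  by rewrite tri_char_adj adjmxZ conjCK -!scalemxAl mxE.
pose B : 'M[C]_(d3, d1 * d2) := \matrix_(i, j) x j i 0.
have BE g : g \in unitmx -> Psi3 g *m B = adjmx w *m H *m T g.
  move=> ug; apply/rowP => j; have := fE (delta_mx j 0) g ug.
  rewrite hx -colE [in RHS]mxE => <-; rewrite !mxE.
  by apply: eq_bigr => i _; rewrite mxE.
have eB g : g \in unitmx -> B *m T g = V3 g *m B.
  move=> ug; apply: mulmx_cV_inj => y; apply/eqP; rewrite -subr_eq0; apply/eqP.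
  apply: inj3 => h; apply/rowP => j; rewrite ord1 [RHS]mxE; move: h.
  apply: (@polyfun_unit_eq _ _ _ (fun=> 0)).
  - apply: (@polyfun_ext _ _ (fun h =>
      \sum_i Psi3 h 0 i * (B *m T g *m y - V3 g *m B *m y) i 0)).
      by apply: polyfun_sum => i; apply: polyfunM => //; exact: polyfun_cst.
    by move=> h; rewrite [RHS]mxE.
  - exact: polyfun_cst.
  move=> h uh; rewrite mulmxBr !mulmxA BE // -(model_right rat3 hm3) //.
  by rewrite BE ?unitmx_mul ?uh // tensor_repM // !mulmxA subrr mxE.
(* This is the adjoint of [B] for the forms [H] and [H3]. That it sends [v3] to [w] is the adjoint
   of [BE] at the identity, where [Psi3] is [adjmx v3 *m H3]. *)
exists (invmx H *m adjmx B *m H3).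
  move=> g ug; have uag : adjmx g \in unitmx by rewrite unitmx_adj.
  rewrite -[LHS]mulmxA cH3 // [LHS]mulmxA.
  have -> : T g = invmx H *m adjmx (T (adjmx g)) *m H.
    by rewrite -mulmxA -cH // mulKmx.
  rewrite [RHS]mulmxA; congr (_ *m _).
  rewrite -[RHS]mulmxA mulKVmx // -[LHS]mulmxA -[RHS]mulmxA.
  by rewrite -!adjmxM eB.
have := BE 1%:M (unitmx1 _ _); rewrite PsiE3 ?unitmx1 // V31 mulmx1.
have -> : T 1%:M = 1%:M.
  have [V11 _ _] := rat1; have [V21 _ _] := rat2.
  rewrite /tensor_rep V11 V21; apply/matrixP => i j; rewrite !mxE -natrM mulnb.
  by rewrite -xpair_eqE -[in RHS](inj_eq (can_inj (@mxtens_unindexK _ _))).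
rewrite mulmx1 => /(congr1 (@adjmx _ _ _)); rewrite !adjmxM !adjmxK aH aH3 => E.
by rewrite -!mulmxA E mulKmx.
Qed.

Lemma semi_inv2_hom F : semi_inv2 lambda mu nu F ->
  exists2 A, equivariant A & forall x, F x = tensor_coef (A *m v3) x.
Proof.
move=> [pF hF]; have h1 := low_tri1 C r.
have [|w Fw] := tensor_coef_surj pF.
  move=> b1 b2 g1 g2 hb1 hb2; have := hF b1 b2 1%:M g1 g2 hb1 hb2.
  by rewrite trmx1 !mulmx1 tri_char1 mulr1 => ->.
have [|A eA Aw] := @hwv_hom w; last by exists A => // x; rewrite Aw.
move=> b hb; apply/eqP; rewrite -subr_eq0; apply/eqP/tensor_coef_inj => -[g1 g2].
rewrite addrC -scaleNr tensor_coef_linear -tensor_coef_right ?upp_tri_unit //.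
have := hF 1%:M 1%:M b g1 g2 h1 h1 hb; rewrite !mul1mx !tri_char1 !mul1r !Fw => ->.
by rewrite mulNr addNr.
Qed.

End Homomorphisms.

(** * Comparison of the two Hom spaces *)

Section Reduction.

(** A linear relation with trivial kernel replaces an injective linear map, since the partner of a
    homomorphism is only known to exist. Partners of a basis are free. *)
Lemma leq_dim_rel (K : fieldType) (E1 E2 : vectType K) (U1 : {vspace E1})
    (U2 : {vspace E2}) (rel : E1 -> E2 -> Prop) :
  rel 0 0 ->
  (forall a x y x' y', rel x y -> rel x' y' -> rel (a *: x + x') (a *: y + y')) ->
  (forall x, x \in U1 -> exists2 y, y \in U2 & rel x y) ->
  (forall x, x \in U1 -> rel x 0 -> x = 0) -> (\dim U1 <= \dim U2)%N.
Proof.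
move=> rel0 relD relU rel_inj.
have bU i : (vbasis U1)`_i \in U1.
  have [iU|iU] := ltnP i (\dim U1); last by rewrite nth_default ?mem0v ?size_tuple.
  by rewrite vbasis_mem // mem_nth // size_tuple.
have /choice[y hy] : forall i : 'I_(\dim U1),
    exists y, y \in U2 /\ rel (vbasis U1)`_i y.
  by move=> i; have [z Uz rz] := relU _ (bU i); exists z.
have fY : free [tuple y i | i < \dim U1].
  apply/freeP => k; rewrite (eq_bigr (fun i => k i *: y i)) => [ky|i _]; last first.
    by rewrite -tnth_nth tnth_mktuple.
  have /freeP := basis_free (vbasisP U1); apply; apply: rel_inj.
    by apply: memv_suml => i _; rewrite memvZ.
  rewrite -ky; elim: (index_enum _) => [|i s IH]; first by rewrite !big_nil.
  by rewrite !big_cons; apply: relD IH; have [] := hy i.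
have <- : size [tuple y i | i < \dim U1] = \dim U1 by rewrite size_tuple.
rewrite -(eqP fY); apply/dimvS/span_subvP => _ /mapP[i _ ->].
by have [] := hy i.
Qed.

Variables (C : numClosedFieldType) (r u v : nat).
Hypotheses (hu : (u <= r)%N) (hv : (v <= r)%N) (huv : (u + v <= r)%N).
Variables (lambda mu nu lambda' mu' nu' : 'I_r -> nat).
Hypotheses (dl : dominant lambda) (dm : dominant mu) (dn : dominant nu).
Hypotheses (dl' : dominant lambda') (dm' : dominant mu') (dn' : dominant nu').
Hypothesis hl : forall i, lambda i = (ones u i + lambda' i)%N.
Hypothesis hm : forall i, mu i = (ones v i + mu' i)%N.
Hypothesis hn : forall i, nu i = (ones (u + v) i + nu' i)%N.
Variables (m N L M : nat).
Hypothesis hL : forall i : 'I_r, (i < u)%N -> (L <= lambda i)%N.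
Hypothesis hM : forall i : 'I_r, (i < v)%N -> (M <= mu i)%N.
Hypothesis hnm : forall i, (nu i <= m)%N.
Hypothesis hnN : forall i : 'I_r, (u + v <= i)%N -> (nu i <= N)%N.
Hypotheses (Lm : (L <= m)%N) (Mm : (M <= m)%N) (NmLM : (N + m < L + M)%N).

Definition hom_space d1 d2 d3 (V1 : 'M[C]_r -> 'M[C]_d1) (V2 : 'M[C]_r -> 'M[C]_d2)
    (V3 : 'M[C]_r -> 'M[C]_d3) (U : {vspace 'M[C]_(d1 * d2, d3)}) :=
  forall A, A \in U <->
    (forall g, g \in unitmx -> A *m V3 g = tensor_rep V1 V2 g *m A).

Lemma hom_space_exists d1 d2 d3 (V1 : 'M[C]_r -> 'M[C]_d1)
    (V2 : 'M[C]_r -> 'M[C]_d2) (V3 : 'M[C]_r -> 'M[C]_d3) :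
  exists U, hom_space V1 V2 V3 U.
Proof.
apply: closed_prop_vspace => [g _|a A B hA hB g ug]; first by rewrite mul0mx mulmx0.
by rewrite mulmxDl mulmxDr -scalemxAl -scalemxAr hA // hB.
Qed.

Lemma hom_space_dim d1 d2 d3 (V1 : 'M[C]_r -> 'M[C]_d1)
    (V2 : 'M[C]_r -> 'M[C]_d2) (V3 : 'M[C]_r -> 'M[C]_d3) U
    d1' d2' d3' (V1' : 'M[C]_r -> 'M[C]_d1')
    (V2' : 'M[C]_r -> 'M[C]_d2') (V3' : 'M[C]_r -> 'M[C]_d3') U' :
  irrep_of_weight lambda V1 -> irrep_of_weight mu V2 -> irrep_of_weight nu V3 ->
  irrep_of_weight lambda' V1' -> irrep_of_weight mu' V2' ->
  irrep_of_weight nu' V3' ->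
  hom_space V1 V2 V3 U -> hom_space V1' V2' V3' U' -> \dim U = \dim U'.
Proof.
case=> [rat1 irr1 [v1 hw1]] [rat2 irr2 [v2 hw2]] [rat3 irr3 [v3 hw3]].
case=> [rat1' irr1' [v1' hw1']] [rat2' irr2' [v2' hw2']] [rat3' irr3' [v3' hw3']].
move=> hU hU'.
have [H1 [Psi1 m1]] := irrep_model dl rat1 irr1 hw1.
have [H2 [Psi2 m2]] := irrep_model dm rat2 irr2 hw2.
have [H3 [Psi3 m3]] := irrep_model dn rat3 irr3 hw3.
have [H1' [Psi1' m1']] := irrep_model dl' rat1' irr1' hw1'.
have [H2' [Psi2' m2']] := irrep_model dm' rat2' irr2' hw2'.
have [H3' [Psi3' m3']] := irrep_model dn' rat3' irr3' hw3'.
have [d1p _] := irr1; have [d2p _] := irr2.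
have [d1p' _] := irr1'; have [d2p' _] := irr2'.
pose D (x : 'M[C]_r * 'M[C]_r) := \det (corner hu hv huv x).
pose F A := tensor_coef Psi1 Psi2 (A *m v3).
pose F' A := tensor_coef Psi1' Psi2' (A *m v3').
have FD a A B x : F (a *: A + B) x = a * F A x + F B x.
  by rewrite /F mulmxDl -scalemxAl tensor_coef_linear.
have F'D a A B x : F' (a *: A + B) x = a * F' A x + F' B x.
  by rewrite /F' mulmxDl -scalemxAl tensor_coef_linear.
have F0 x : F 0 x = 0 by rewrite /F mul0mx /tensor_coef mulmx0 mxE.
have F'0 x : F' 0 x = 0 by rewrite /F' mul0mx /tensor_coef mulmx0 mxE.
(* Division by the minor gives every [A] a partner, multiplication gives one to every [A']; the two
   inequalities use [rel] in opposite directions. *)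
pose rel A A' := forall x, F A x = D x * F' A' x.
have rel0 : rel 0 0 by move=> x; rewrite F0 F'0 mulr0.
have relD a A A' B B' : rel A A' -> rel B B' -> rel (a *: A + B) (a *: A' + B').
  by move=> hA hB x; rewrite FD F'D hA hB; ring.
apply/eqP; rewrite eqn_leq; apply/andP; split.
  apply: (leq_dim_rel (rel := rel)) => // A /hU eA.
    have [Q sQ FQ] := semi_inv2_div_corner hu hv huv hl hm hn
      (hom_semi_inv2 rat1 rat2 rat3 hw3 m1 m2 eA) hL hM hnm hnN Lm Mm NmLM.
    have [A' eA' QA'] := semi_inv2_hom rat1' rat2' rat3' d1p' d2p' m1' m2' m3' sQ.
    by exists A'; [apply/hU' | move=> x; rewrite /F /F' -QA' FQ].
  move=> A0; apply: (hom_inj d1p d2p irr3 hw3 m1 m2 eA) => x.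
  by have := A0 x; rewrite F'0 mulr0.
apply: (leq_dim_rel (rel := fun A' A => rel A A')) => // [a A' A B' B||].
- exact: relD.
- move=> A' /hU' eA'.
  have [A eA FA] := semi_inv2_hom rat1 rat2 rat3 d1p d2p m1 m2 m3
    (semi_inv2_mul_corner hu hv huv hl hm hn
      (hom_semi_inv2 rat1' rat2' rat3' hw3' m1' m2' eA')).
  by exists A; [apply/hU | move=> x; rewrite /F -FA].
move=> A' /hU' eA' A0; apply: (hom_inj d1p' d2p' irr3' hw3' m1' m2' eA').
have pF' := tensor_coef_poly m1' m2' (A' *m v3').
apply: (det_corner_cancel (hu := hu) (hv := hv) (huv := huv) pF').
by move=> x; rewrite -[_ * _]A0 F0.
Qed.

Theorem LRcoef_corner : LRcoef C lambda mu nu = LRcoef C lambda' mu' nu'.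
Proof.
rewrite /LRcoef; congr (classical_sets.xget _ _).
apply/funext => c; apply/propext.
split=> -[d1 [d2 [d3 [V1 [V2 [V3 [w1 w2 w3 [U [hU dU]]]]]]]]].
  have [d1' [V1' w1']] := irrep_exists C dl'.
  have [d2' [V2' w2']] := irrep_exists C dm'.
  have [d3' [V3' w3']] := irrep_exists C dn'.
  have [U' hU'] := hom_space_exists V1' V2' V3'.
  exists d1', d2', d3', V1', V2', V3'; split=> //; exists U'; split=> //.
  by rewrite -dU; apply/esym; apply: (hom_space_dim w1 w2 w3 w1' w2' w3').
have [d1' [V1' w1']] := irrep_exists C dl.
have [d2' [V2' w2']] := irrep_exists C dm.
have [d3' [V3' w3']] := irrep_exists C dn.
have [U' hU'] := hom_space_exists V1' V2' V3'.
exists d1', d2', d3', V1', V2', V3'; split=> //; exists U'; split=> //.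
by rewrite -dU; apply: (hom_space_dim w1' w2' w3' w1 w2 w3).
Qed.

End Reduction.

(** * Index sets *)

Local Close Scope ring_scope.
Local Open Scope nat_scope.

Section IndexSets.
Local Open Scope fset_scope.
Local Open Scope nat_scope.
Implicit Types (I J K : {fset nat}).

Lemma elt0 I : elt I 0 = 0. Proof. by []. Qed.

Lemma elt_sorted n r I : rsubset n r I ->
  path ltn 0 (sort leq (enum_fset I)) /\ size (sort leq (enum_fset I)) = r.
Proof.
move=> [cI hI]; split; last by rewrite size_sort -cI.
rewrite path_min_sorted; last first.
  by apply/allP => i; rewrite mem_sort => /hI /andP[].
by rewrite ltn_sorted_uniq_leq sort_uniq fset_uniq sort_sorted.
Qed.

Lemma elt_lt n r I p q : rsubset n r I -> p < q <= r -> elt I p < elt I q.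
Proof.
move=> hI /andP[pq qr]; have [sI zI] := elt_sorted hI.
have h : sorted ltn (0 :: sort leq (enum_fset I)) by [].
apply: (sorted_ltn_nth ltn_trans 0 h) => //; rewrite inE /= zI ltnS //.
by rewrite ltnW // (leq_trans pq).
Qed.

Lemma elt_gap n r I p q : rsubset n r I -> p <= q <= r ->
  elt I p + (q - p) <= elt I q.
Proof.
move=> hI /andP[]; elim: q => [|q IH]; first by rewrite leqn0 => /eqP ->.
rewrite leq_eqVlt => /predU1P[-> _|pq qr]; first by rewrite subnn addn0.
have := IH pq (ltnW qr); have := @elt_lt n r I q q.+1 hI; rewrite ltnSn qr /=.
by move=> /(_ isT); lia.
Qed.

Lemma elt_le n r I p : rsubset n r I -> p <= r -> elt I p + (r - p) <= n.
Proof.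
move=> hI pr; have := @elt_gap n r I p r hI; rewrite pr leqnn => /(_ isT).
move=> h; apply: leq_trans h _.
case: r hI pr => [|r] hI pr; first by rewrite elt0.
have [_ zI] := elt_sorted hI; have [_ hle] := hI.
rewrite /elt /=; have /hle/andP[_ //] : nth 0 (sort leq (enum_fset I)) r \in I.
by rewrite -[_ \in I](mem_sort leq) mem_nth // zI.
Qed.

Lemma sort_imfset r (f : nat -> nat) :
  (forall p q, 0 < p -> p < q -> q <= r -> f p < f q) ->
  sort leq (enum_fset [fset f p | p in iota 1 r]) = map f (iota 1 r).
Proof.
move=> hf; apply: (irr_sorted_eq ltn_trans ltnn).
- by rewrite ltn_sorted_uniq_leq sort_uniq fset_uniq sort_sorted.
- rewrite sorted_map.
  apply: (sub_in_sorted (P := fun i => 0 < i <= r)) (iota_ltn_sorted 1 r).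
    by move=> a b /andP[a0 ar] /andP[b0 br] ab; exact: hf.
  by apply/allP => a; rewrite mem_iota; lia.
- by move=> x; rewrite mem_sort; apply/imfsetP/mapP => -[a /= ha ->]; exists a.
Qed.

Lemma elt_imfset r (f : nat -> nat) p :
  (forall p q, 0 < p -> p < q -> q <= r -> f p < f q) -> 0 < p <= r ->
  elt [fset f p | p in iota 1 r] p = f p.
Proof.
move=> hf /andP[p0 pr]; rewrite /elt -{1}(prednK p0) /= sort_imfset //.
rewrite (nth_map 0) ?size_iota ?nth_iota; try lia.
by congr f; lia.
Qed.

Lemma mem_elt n r I i : rsubset n r I ->
  (i \in I) = has (fun p => elt I p == i) (iota 1 r).
Proof.
move=> hI; have [_ zI] := elt_sorted hI.
rewrite -[_ \in I](mem_sort leq); apply/idP/hasP => [iI|[p]].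
  exists (index i (sort leq (enum_fset I))).+1.
    by rewrite mem_iota /= add1n ltnS -zI index_mem.
  by rewrite /elt /= nth_index.
rewrite mem_iota => /andP[p0 pr] /eqP <-.
by rewrite /elt -(prednK p0) /= mem_nth // zI; lia.
Qed.

Lemma elt_sigma n r I p : rsubset n r I -> 0 < p <= r ->
  elt (sigma n I) p = n.+1 - elt I (r.+1 - p).
Proof.
move=> hI hp; pose f p := n.+1 - elt I (r.+1 - p).
have -> : sigma n I = [fset f p | p in iota 1 r].
  apply/fsetP => x; apply/imfsetP/imfsetP => -[a /= ha ->].
    move: ha; rewrite /= (mem_elt _ hI) => /hasP[q]; rewrite mem_iota => hq /eqP <-.
    exists (r.+1 - q); first by rewrite /= mem_iota; lia.
    by rewrite /f; congr (_ - elt I _); lia.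
  rewrite /= in ha; exists (elt I (r.+1 - a)) => //.
  rewrite /= (mem_elt _ hI); apply/hasP; exists (r.+1 - a) => //.
  by move: ha; rewrite !mem_iota; lia.
apply: elt_imfset => // a b a0 ab br; rewrite /f.
have := @elt_lt n r I (r.+1 - b) (r.+1 - a) hI.
have := @elt_le n r I (r.+1 - a) hI; lia.
Qed.

Lemma rsubset_sigma n r I : rsubset n r I -> rsubset n r (sigma n I).
Proof.
move=> [cI hI]; split.
  rewrite -cI; apply: card_in_imfset => a b /= /hI ha /hI hb; lia.
by move=> i /imfsetP[a /= /hI ha ->]; lia.
Qed.

(** The order reversals of [rho] and [sigma] cancel, so the first parts come from the small elements
    of [I]; for [K], where only [rho] acts, they come from the large ones. *)
Lemma rho_sigma n r I (a : 'I_r) : rsubset n r I ->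
  rho (sigma n I) a = n.+1 - elt I a.+1 - (r - a).
Proof.
move=> hI; have ar := ltn_ord a; rewrite /rho (elt_sigma hI); last lia.
by congr (_ - elt I _ - _); lia.
Qed.

Lemma reduced_increasing n r u I p q : rsubset n r I ->
  u = r \/ 2 <= elt I u.+1 - elt I u -> 0 < p -> p < q -> q <= r ->
  (if p <= u then elt I p else (elt I p).-1)
  < (if q <= u then elt I q else (elt I q).-1).
Proof.
move=> hI gap p0 pq qr; have ltpq := @elt_lt n r I p q hI.
have pu' := @elt_gap n r I p u hI; have uq' := @elt_gap n r I u.+1 q hI.
have hp := @elt_gap n r I 0 p hI; rewrite elt0 in hp.
by case: (leqP p u) => pu; case: (leqP q u) => qu; lia.
Qed.

Lemma elt_reduced n r u I p : rsubset n r I ->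
  u = r \/ 2 <= elt I u.+1 - elt I u -> 0 < p <= r ->
  elt (reduced r u I) p = if p <= u then elt I p else (elt I p).-1.
Proof.
move=> hI gap hp.
apply: (@elt_imfset r (fun p => if p <= u then elt I p else (elt I p).-1)) => // a b.
exact: reduced_increasing hI gap.
Qed.

(** For [u = 0] the gap condition reads [2 <= elt I 1], so the lowered elements stay positive; the
    bound on [elt I u] keeps the elements left in place within the smaller range. *)
Lemma rsubset_reduced n r u I : rsubset n r I ->
  u = r \/ 2 <= elt I u.+1 - elt I u -> u <= r -> elt I u <= n - 1 ->
  rsubset (n - 1) r (reduced r u I).
Proof.
move=> hI gap ur eu; split.
  rewrite -[#|` _|](size_sort leq).
  rewrite (@sort_imfset r (fun p => if p <= u then elt I p else (elt I p).-1)).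
    by rewrite size_map size_iota.
  by move=> a b; exact: reduced_increasing hI gap.
move=> i /imfsetP[p /=]; rewrite mem_iota => hp ->.
have lp := @elt_le n r I p hI; have ep := @elt_gap n r I 0 p hI.
have pu' := @elt_gap n r I p u hI; have up' := @elt_gap n r I u.+1 p hI.
rewrite elt0 in ep; case: (leqP p u) => pu; lia.
Qed.

Lemma dominant_rho_sigma n r I : rsubset n r I -> dominant (@rho r (sigma n I)).
Proof.
move=> hI i j ij; rewrite !(rho_sigma _ hI).
by have := @elt_gap n r I i.+1 j.+1 hI; have := ltn_ord j; lia.
Qed.

Lemma dominant_rho n r K : rsubset n r K -> dominant (@rho r K).
Proof.
move=> hK i j ij; rewrite /rho; have := @elt_gap n r K (r - j) (r - i) hK.
by have := ltn_ord j; lia.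
Qed.

Lemma rho_sigma_reduced n r u I (a : 'I_r) : rsubset n r I ->
  u = r \/ 2 <= elt I u.+1 - elt I u -> u <= r -> elt I u <= n - 1 -> 0 < n ->
  rho (sigma n I) a = ones u a + rho (sigma (n - 1) (reduced r u I)) a.
Proof.
move=> hI gap ur eu n0; have hR := rsubset_reduced hI gap ur eu.
have ar := ltn_ord a; rewrite (rho_sigma _ hI) (rho_sigma _ hR) /ones.
rewrite (elt_reduced hI gap); last lia.
have au := @elt_gap n r I a.+1 u hI; have ea := @elt_le n r I a.+1 hI.
have e0 := @elt_gap n r I 0 a.+1 hI; rewrite elt0 in e0.
have eu1 := @elt_le n r I u.+1 hI.
by case: ltnP => hau; lia.
Qed.

Lemma rho_reduced n r w s K (a : 'I_r) : rsubset n r K ->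
  w = r \/ 2 <= elt K w.+1 - elt K w -> s + w = r ->
  rho K a = ones s a + rho (reduced r w K) a.
Proof.
move=> hK gap sw; have ar := ltn_ord a.
rewrite /rho /ones (elt_reduced hK gap); last lia.
have e0 := @elt_gap n r K 0 w hK; rewrite elt0 in e0.
have ew := @elt_gap n r K w.+1 (r - a) hK.
case: ltnP => sa; case: leqP => rw; lia.
Qed.

Lemma rho_sigma_ge n r u I (a : 'I_r) : rsubset n r I -> a < u -> u <= r ->
  n - elt I u - (r - u) <= rho (sigma n I) a.
Proof.
move=> hI au ur; rewrite (rho_sigma _ hI).
have : elt I a.+1 + (u - a.+1) <= elt I u by apply: elt_gap hI _; rewrite au.
by lia.
Qed.

Lemma rho_le n r K (a : 'I_r) : rsubset n r K -> rho K a <= n - r.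
Proof. by move=> hK; have := elt_le hK (leq_subr a r); rewrite /rho; lia. Qed.

Lemma rho_le_elt n r w K (a : 'I_r) : rsubset n r K -> w <= r -> r - w <= a ->
  rho K a <= elt K w - w.
Proof.
move=> hK wr wa; rewrite /rho.
have : elt K (r - a) + (w - (r - a)) <= elt K w by apply: elt_gap hK _; lia.
by have := ltn_ord a; lia.
Qed.

Lemma leq_elt n r I p : rsubset n r I -> p <= r -> p <= elt I p.
Proof.
by move=> hI pr; have := @elt_gap n r I 0 p hI; rewrite elt0 add0n subn0 leq0n; apply.
Qed.

End IndexSets.

Lemma hornTtilde_rsubset n r (I J K : {fset nat}) : hornTtilde n r I J K ->
  [/\ rsubset n r I, rsubset n r J & rsubset n r K].
Proof.
move=> [I' [J' [hT -> ->]]].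
have [rI rJ rK _] : hornU n r I' J' K.
  by move: hT; rewrite /hornT; case: (r) => [|r'] [].
by split=> //; exact: rsubset_sigma.
Qed.

Theorem proposition3p10 (R : realType) (n r : nat) (I J K : {fset nat})
    (u v w : nat) :
  1 <= r -> r <= n ->
  hornTtilde n r I J K ->
  u <= r -> v <= r -> w <= r ->
  u + v + w = r ->
  u = r \/ 2 <= elt I u.+1 - elt I u ->
  v = r \/ 2 <= elt J v.+1 - elt J v ->
  w = r \/ 2 <= elt K w.+1 - elt K w ->
  elt I u + elt J v + elt K w <= n - 1 ->
  horn_LRcoef R (n - 1) r (reduced r u I) (reduced r v J) (reduced r w K)
  = horn_LRcoef R n r I J K.
Proof.
move=> r1 rn /hornTtilde_rsubset[hI hJ hK] ur vr wr uvw gapI gapJ gapK hsum.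
have [n0 uvr] : 0 < n /\ u + v <= r by split; lia.
have [eI eJ eK] : [/\ elt I u <= n - 1, elt J v <= n - 1 & elt K w <= n - 1].
  by split; lia.
have hI' := rsubset_reduced hI gapI ur eI.
have hJ' := rsubset_reduced hJ gapJ vr eJ.
have hK' := rsubset_reduced hK gapK wr eK.
have [Iu Jv Kw] : [/\ u <= elt I u, v <= elt J v & w <= elt K w].
  by split; [exact: leq_elt hI ur | exact: leq_elt hJ vr | exact: leq_elt hK wr].
have := elt_le hI ur; have := elt_le hJ vr => Jn In.
(* By the bounds just collected none of these subtractions truncates; what remains is condition (e)
   rewritten with [u + v + w = r]. *)
have sum_lt : (elt K w - w) + (n - r)
    < (n - elt I u - (r - u)) + (n - elt J v - (r - v)).
  by move: r1 rn uvw hsum Iu Jv Kw Jn In; clear; lia.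
(* [n - elt I u - (r - u)] is lambda_u, with the convention lambda_0 = n - r; the same
   holds for J, and [elt K w - w] is nu_(u+v+1), with nu_(r+1) = 0. *)
apply/esym; apply: (@LRcoef_corner _ r u v ur vr uvr _ _ _ _ _ _
  _ _ _ _ _ _ _ _ _ (n - r) (elt K w - w)
  (n - elt I u - (r - u)) (n - elt J v - (r - v))).
- exact: dominant_rho_sigma hI.
- exact: dominant_rho_sigma hJ.
- exact: dominant_rho hK.
- exact: dominant_rho_sigma hI'.
- exact: dominant_rho_sigma hJ'.
- exact: dominant_rho hK'.
- by move=> a; exact: rho_sigma_reduced.
- by move=> a; exact: rho_sigma_reduced.
- by move=> a; exact: rho_reduced hK gapK uvw.
- by move=> a au; exact: rho_sigma_ge.
- by move=> a av; exact: rho_sigma_ge.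
- by move=> a; exact: rho_le.
- by move=> a ha; apply: rho_le_elt hK wr _; rewrite -[X in X - w]uvw addnK.
- by move: ur Iu; clear; lia.
- by move: vr Jv; clear; lia.
- exact: sum_lt.
Qed.
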